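(* Suppose that $T$ defines an exponential function $\exp$, and let $\mathcal{R}=(\mathcal{R},\mathcal{O},\mathfrak{M})\models T_{\mathfrak{M}}$. Then there is an $\mathcal{L}_{\mathfrak{M}}$-definable (with parameters) set $A\subseteq\mathcal{R}$ with $\mathbb{N}\subseteq A$ such that if $a\in A\setminus\mathbb{N}$, then $a>\mathbb{N}$ (that is, $a>n$ for all $n\in\mathbb{N}$). Consequently, $\mathbb{N}$ is externally definable in any model of $T_{\mathfrak{M}}$, and if $T$ has an archimedean model, then $\mathbb{N}$ is definable in some model of $T_{\mathfrak{M}}$.
   Context: $\mathcal{L}$ is a language extending the language $\{0,1,<,+,-,\cdot\}$ of ordered rings and $T$ is a complete o-minimal $\mathcal{L}$-theory extending the theory of real closed ordered fields. For $\mathcal{R}\models T$, an exponential function is an isomorphism $\exp\colon\mathcal{R}\to\mathcal{R}^{>}$ from the ordered additive group of $\mathcal{R}$ onto the ordered multiplicative group $\mathcal{R}^>=\{a\in\mathcal{R}:a>0\}$ that is equal to its own derivative. If $\mathcal{R}$ defines an exponential function $\exp$, then $\exp$ is $\mathcal{L}(\emptyset)$-definable, so it is defined uniformly in all models of $T$; one then says that $T$ defines an exponential function. A $T$-convex subring of $\mathcal{R}\models T$ is a convex subset $\mathcal{O}\subseteq\mathcal{R}$ closed under all $\mathcal{L}(\emptyset)$-definable continuous functions $\mathcal{R}\to\mathcal{R}$ (it is then a valuation ring). $T_{\mathcal{O}}$ is the theory in $\mathcal{L}_{\mathcal{O}}=\mathcal{L}\cup\{\mathcal{O}\}$ extending $T$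 by axioms saying that $\mathcal{O}$ is a proper $T$-convex subring. For $(\mathcal{R},\mathcal{O})\models T_{\mathcal{O}}$, $\Gamma=\mathcal{R}^\times/\mathcal{O}^\times$ is the value group and $v\colon\mathcal{R}^\times\to\Gamma$ the valuation. A monomial group for $(\mathcal{R},\mathcal{O})$ is a multiplicative subgroup $\mathfrak{M}\subseteq\mathcal{R}^\times$ such that $v\colon\mathfrak{M}\to\Gamma$ is a group isomorphism (necessarily $\mathfrak{M}\subseteq\mathcal{R}^>$). When $T$ defines an exponential function, $\mathfrak{M}$ is $T$-compatible if $\mathfrak{M}^{\succ}=\{\mathfrak{m}\in\mathfrak{M}:\mathfrak{m}>1\}$ is closed under $\exp$. $T_{\mathfrak{M}}$ is the theory in $\mathcal{L}_{\mathfrak{M}}=\mathcal{L}_{\mathcal{O}}\cup\{\mathfrak{M}\}$ extending $T_{\mathcal{O}}$ by axioms saying that $\mathfrak{M}$ is a $T$-compatible monomial group. $\mathbb{N}=\{0,1,2,\dots\}$ is identified with its image in $\mathcal{R}$. A subset of $\mathcal{R}$ is externally definable if it is the intersection with $\mathcal{R}$ of a set definable with parameters in an elementary extension of $\mathcal{R}$. *)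

(* Defs.v *)
From mathcomp Require Import all_boot all_order all_algebra.
From mathcomp Require Import boolp classical_sets functions.

Set Implicit Arguments.
Unset Strict Implicit.
Unset Printing Implicit Defensive.

Import Order.TTheory GRing.Theory Num.Theory.
Local Open Scope classical_set_scope.

(** * First-order logic *)

Record language : Type := Language {
  fsym : Type;
  farity : fsym -> nat;
  rsym : Type;
  rarity : rsym -> nat }.

(* No non-emptiness is demanded of the carrier: every language considered
   below has constant symbols. *)
Record structure (L : language) : Type := Structure {
  car :> Type;
  finterp : forall f : fsym L, ('I_(farity f) -> car) -> car;
  rinterp : forall r : rsym L, ('I_(rarity r) -> car) -> Prop }.

Inductive term (L : language) (n : nat) : Type :=
| Var of 'I_n
| App (f : fsym L) of 'I_(farity f) -> term L n.

(* [formula L n] is the type of L-formulas with free variables among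
   x_0, ..., x_(n-1). In [All p] the quantified variable is x_0 of [p], and
   x_(i+1) of [p] is x_i of [All p]. *)
Inductive formula (L : language) (n : nat) : Type :=
| Equal of term L n & term L n
| Rel (r : rsym L) of 'I_(rarity r) -> term L n
| Bot
| Imp of formula L n & formula L n
| All of formula L n.+1.

Definition vcons (X : Type) (n : nat) (x : X) (v : 'I_n -> X) : 'I_n.+1 -> X :=
  fun i => oapp v x (unlift ord0 i).

Fixpoint eval (L : language) (M : structure L) (n : nat) (v : 'I_n -> M)
    (t : term L n) : M :=
  match t with
  | Var i => v i
  | App f a => finterp (fun i => eval v (a i))
  end.

Fixpoint sat (L : language) (M : structure L) (n : nat) (p : formula L n) :
    ('I_n -> M) -> Prop :=
  match p with
  | Equal t u => fun v => eval v t = eval v u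
  | Rel r a => fun v => rinterp (fun i => eval v (a i))
  | Bot => fun=> False
  | Imp p q => fun v => sat p v -> sat q v
  | All p => fun v => forall x : M, sat p (vcons x v)
  end.

Definition theory (L : language) : Type := set (formula L 0).

Definition holds (L : language) (M : structure L) (s : formula L 0) : Prop :=
  sat (M := M) s (tnth [tuple]).

Definition model (L : language) (T : theory L) (M : structure L) : Prop :=
  forall s, T s -> holds M s.

Definition entails (L : language) (T : theory L) (s : formula L 0) : Prop :=
  forall M : structure L, model T M -> holds M s.

Definition complete (L : language) (T : theory L) : Prop :=
  (exists M : structure L, model T M) /\
  forall s, entails T s \/ entails T (Imp s (Bot L 0)).

(* Definability with parameters. *)
Definition definable (L : language) (M : structure L) (A : set M) : Prop :=
  exists (k : nat) (p : formula L k.+1) (c : 'I_k -> M),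
    A = [set x | sat p (vcons x c)].

Definition defines_fun (L : language) (M : structure L) (p : formula L 2)
    (f : M -> M) : Prop :=
  forall x y : M, sat p (tnth [tuple x; y]) <-> y = f x.

(* L(∅)-definability: no parameters. *)
Definition definable0_fun (L : language) (M : structure L) (f : M -> M) : Prop :=
  exists p : formula L 2, defines_fun p f.

Definition elementary (L : language) (M N : structure L) (j : M -> N) : Prop :=
  forall (n : nat) (p : formula L n) (v : 'I_n -> M),
    sat p v <-> sat p (j \o v).

Definition externally_definable (L : language) (M : structure L) (A : set M) :
    Prop :=
  exists (N : structure L) (j : M -> N) (B : set N),
    [/\ elementary j, definable B & A = j @^-1` B].

(** * Expansions of languages *)

Definition lang_sum (L1 L2 : language) : language :=
  @Language (fsym L1 + fsym L2)
    (fun f => match f with inl f => farity f | inr f => farity f end)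
    (rsym L1 + rsym L2)
    (fun r => match r with inl r => rarity r | inr r => rarity r end).

Definition reduct (L1 L2 : language) (M : structure (lang_sum L1 L2)) :
    structure L1 :=
  @Structure L1 M
    (fun f => @finterp _ M (inl f))
    (fun r => @rinterp _ M (inl r)).

Definition upred : language :=
  @Language Empty_set (fun=> 0) unit (fun=> 1).

Definition add_pred (L : language) : language := lang_sum L upred.

Definition upred_set (L : language) (M : structure (add_pred L)) : set M :=
  [set x | @rinterp _ M (inr tt) (tnth [tuple x])].

(** * Ordered rings *)

Inductive oring_fsym := OZero | OOne | OAdd | OOpp | OMul.

Inductive oring_rsym := OLt.

Definition oring : language :=
  @Language oring_fsym
    (fun f => match f with
              | OZero => 0 | OOne => 0 | OAdd => 2 | OOpp => 1 | OMul => 2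
              end)
    oring_rsym (fun=> 2).

(* Up to renaming of symbols, the languages extending that of ordered rings
   are the [oring_ext E], with E the language of the additional symbols. *)
Definition oring_ext (E : language) : language := lang_sum oring E.

Section OrderedRing.
Context {E : language} (R : structure (oring_ext E)).
Implicit Types x y z : R.

Definition zero : R := @finterp _ R (inl OZero) (tnth [tuple]).
Definition one : R := @finterp _ R (inl OOne) (tnth [tuple]).
Definition add x y : R := @finterp _ R (inl OAdd) (tnth [tuple x; y]).
Definition opp x : R := @finterp _ R (inl OOpp) (tnth [tuple x]).
Definition mul x y : R := @finterp _ R (inl OMul) (tnth [tuple x; y]).
Definition lt x y : Prop := @rinterp _ R (inl OLt) (tnth [tuple x; y]).

Definition is_rcf : Prop :=
  exists (F : rcfType) (f : R -> F),
    [/\ bijective f, f zero = 0%R & f one = 1%R] /\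
    [/\ forall x y, f (add x y) = (f x + f y)%R,
        forall x, f (opp x) = (- f x)%R,
        forall x y, f (mul x y) = (f x * f y)%R
      & forall x y, lt x y <-> (f x < f y)%R].

Fixpoint natr (n : nat) : R := if n is m.+1 then add (natr m) one else zero.

Definition naturals : set R := range natr.

Definition archimedean : Prop := forall x, exists n, lt x (natr n).

(* |x - y| < e *)
Definition dist_lt e x y : Prop := lt x (add y e) /\ lt y (add x e).

Definition continuous_fun (f : R -> R) : Prop :=
  forall x e, lt zero e -> exists2 d, lt zero d &
    forall y, dist_lt d x y -> dist_lt e (f x) (f y).

(* b is the derivative of f at x: for h <> 0 close to 0, the difference
   quotient q = (f (x + h) - f x) / h is close to b. *)
Definition has_derivative (f : R -> R) x b : Prop :=
  forall e, lt zero e -> exists2 d, lt zero d &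
    forall h q, h <> zero -> dist_lt d h zero ->
      mul q h = add (f (add x h)) (opp (f x)) -> dist_lt e q b.

Definition exponential (e : R -> R) : Prop :=
  [/\ set_bij setT [set y | lt zero y] e,
      forall x y, e (add x y) = mul (e x) (e y),
      forall x y, lt x y <-> lt (e x) (e y)
    & forall x, has_derivative e x (e x)].

(* In [Itv a b], [None] stands for -oo as [a] and for +oo as [b]. *)
Inductive piece := Point of R | Itv of option R & option R.

Definition piece_set (c : piece) : set R :=
  match c with
  | Point a => [set a]
  | Itv a b => [set x | (if a is Some a then lt a x else True) /\
                        (if b is Some b then lt x b else True)]
  end.

Definition o_minimal_structure : Prop :=
  forall A : set R, definable A ->
    exists (n : nat) (c : 'I_n -> piece), A = \bigcup_i piece_set (c i).

Definition subring (O : set R) : Prop :=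
  [/\ O one, forall x y, O x -> O y -> O (add x (opp y))
    & forall x y, O x -> O y -> O (mul x y)].

Definition convex (O : set R) : Prop :=
  forall x y z, O x -> O z -> lt x y -> lt y z -> O y.

Definition T_convex_subring (O : set R) : Prop :=
  [/\ subring O, convex O
    & forall f : R -> R, definable0_fun f -> continuous_fun f ->
        forall x, O x -> O (f x)].

Definition proper (O : set R) : Prop := exists x, ~ O x.

Definition units_of (O : set R) : set R :=
  [set u | O u /\ exists2 w, O w & mul u w = one].

(* The value group R^x / O^x is realized as the set of the cosets a O^x; the
   valuation maps a to its coset. *)
Definition valuation (O : set R) (a : R) : set R := mul a @` units_of O.

Definition value_group (O : set R) : set (set R) :=
  valuation O @` [set a | a <> zero].

Definition mult_subgroup (G : set R) : Prop :=
  [/\ forall x, G x -> x <> zero, G one,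
      forall x y, G x -> G y -> G (mul x y)
    & forall x y, G x -> mul x y = one -> G y].

(* The valuation is multiplicative on R^x, so its restriction to G is a group
   isomorphism onto the value group as soon as it is bijective. *)
Definition monomial_group (O G : set R) : Prop :=
  mult_subgroup G /\ set_bij G (value_group O) (valuation O).

End OrderedRing.

Arguments natr {E} R n.
Arguments naturals {E} R _.

(** * Theories of ordered fields *)

Definition langO (E : language) : language := add_pred (oring_ext E).
Definition langM (E : language) : language := add_pred (langO E).

(* The L-reduct of an L_M-structure. *)
Definition ring_reduct (E : language) (S : structure (langM E)) :
    structure (oring_ext E) :=
  reduct (reduct S).

Section Theories.
Context {E : language} (T : theory (oring_ext E)).

Definition o_minimal : Prop :=
  forall R, model T R -> o_minimal_structure R.

Definition extends_rcf : Prop :=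
  forall R, model T R -> is_rcf R.

(* [expf] defines, without parameters and uniformly in the models of T, an
   exponential function. *)
Definition defines_exponential (expf : formula (oring_ext E) 2) : Prop :=
  forall R, model T R -> exists2 e : R -> R, exponential e & defines_fun expf e.

(* T_O and T_M enter only through their models: [TO_model] and [TM_model]
   spell out, for a structure, what the axioms of these theories express. *)
Definition TO_model (S : structure (langO E)) : Prop :=
  [/\ model T (reduct S),
      T_convex_subring (R := reduct S) (upred_set (M := S))
    & proper (R := reduct S) (upred_set (M := S))].

Definition T_compatible (expf : formula (oring_ext E) 2)
    (R : structure (oring_ext E)) (G : set R) : Prop :=
  forall m y, G m -> lt (one R) m -> sat expf (tnth [tuple m; y]) ->
    G y /\ lt (one R) y.

Definition TM_model (expf : formula (oring_ext E) 2) (S : structure (langM E)) :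
    Prop :=
  let R := ring_reduct S in
  let O := upred_set (M := reduct S) : set R in
  let G := upred_set (M := S) : set R in
  [/\ TO_model (reduct S), monomial_group O G & T_compatible expf G].

End Theories.

(* Main.v *)
Require Import Defs.
From mathcomp Require Import all_boot all_order all_algebra.
From mathcomp Require Import boolp classical_sets functions filter.
From mathcomp Require Import ring lra.

Set Implicit Arguments.
Unset Strict Implicit.
Unset Printing Implicit Defensive.

Import Defs.
Import Order.TTheory GRing.Theory Num.Theory.
Local Open Scope classical_set_scope.

(** Fix a monomial [m > 1] and put [X = exp m], again a monomial. The logarithms
    of the monomials form an additive group which meets [O] only in 0, because
    [O] is closed under [exp], and which contains the monomials greater than
    1. For a positive integer [a] the geometric sum [(X^a - 1)/(X - 1)]
    equals [1 + X + ... + X^(a-1)], so that subtracting 1 leaves the logarithm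
    of a monomial. For [n < a < n + 1] such that [X^a] is a monomial, the same
    sum is [X^(a-1) + ... + X^(a-n)] plus an element of the interval (0, 1);
    subtracting 1 and the monomials leaves a nonzero element of [O], which is
    not the logarithm of a monomial. The set [A] is given by the condition
    that [a = 0] or that [a > 0], [X^a] is a monomial and the geometric sum
    minus 1 is the logarithm of a monomial ([cut_set], [nat_cut_gap]).

    For external definability, let [c] be the class of the identity sequence
    in a nonprincipal ultrapower indexed by [nat]. An element of the structure
    is below [c] exactly when it is below some natural number, so the natural
    numbers are the trace of the extension of [A] cut off at [c]
    ([externally_definable_nat]).

    For the last part it is enough to find a model of T_M in which [O] consists
    of the finite elements: the natural numbers are then [A] intersected with
    [O]. The field is an ultrapower of an archimedean model. Its finite
    elements are T-convex because definable continuous functions are bounded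
    on bounded intervals of the archimedean model, by o-minimality
    ([continuous_bounded]), and the bounds transfer ([T_convex_finite]). The
    monomial group comes from a Zorn argument valid for every convex subring
    closed under an exponential such that [1 + x/2 <= exp x] for [x > 0]
    ([exists_monomials]): one looks for a rational subspace [L], to be the set
    of logarithms of monomials, which is a complement of [O] and is closed
    under [exp] on its positive elements. Consider the subspaces [W] meeting
    [O] only in 0 in which the valuation of every nonzero element is that of
    some [exp u] with [u] and [exp u] in [W] ([log_space]). A maximal such
    [L] is closed under [exp] on its positive elements, since adjoining a
    missing [exp u] causes no cancellation. If some [w] is not in [L + O],
    there are two cases. Either every [w - y], for [y] in [L], has the valuation
    of an element of [exp L], and [w] can be adjoined; or some [w - y] does not,
    and one passes to the logarithm of its absolute value. Either the first
    case occurs after finitely many steps, or the infinite chain of iterated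
    logarithms so obtained can be adjoined as a whole ([adjoin_chain]). Both
    contradict maximality. *)

(** * Convex subrings of a real closed field *)

Section ConvexSubring.
Local Open Scope ring_scope.
Context {F : rcfType} (O : set F).
Context (O1 : O 1) (OB : forall x y, O x -> O y -> O (x - y)).
Context (OM : forall x y, O x -> O y -> O (x * y)).
Context (Ocv : forall x y z, O x -> O z -> x < y -> y < z -> O y).

Lemma convex_0 : O 0. Proof. by rewrite -(subrr 1); apply: OB. Qed.

Lemma convex_N x : O x -> O (- x).
Proof. by rewrite -(sub0r x); apply: OB; exact: convex_0. Qed.

Lemma convex_D x y : O x -> O y -> O (x + y).
Proof. by move=> Ox Oy; rewrite -(opprK y); apply/OB/convex_N. Qed.

Lemma convex_nat n : O n%:R.
Proof.
by elim: n => [|n IH]; [exact: convex_0 | rewrite -natr1; apply: convex_D].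
Qed.

Lemma convex_le x y : O y -> `|x| <= `|y| -> O x.
Proof.
move=> Oy xy.
have Oay : O `|y| by case: (ger0P y) => // _; exact: convex_N.
have [->//|ney] := eqVneq x `|y|.
have [->|neNy] := eqVneq x (- `|y|); first exact: convex_N.
move: xy; rewrite ler_norml => /andP[].
rewrite le_eqVlt eq_sym (negPf neNy) /= => h1.
rewrite le_eqVlt (negPf ney) /= => h2.
by apply: (Ocv (convex_N Oay) Oay).
Qed.

Lemma convex_norm x : O `|x| <-> O x.
Proof. by split=> /convex_le; apply; rewrite normr_id. Qed.

Lemma convex_ratr q : O (ratr q).
Proof.
have le_qn := ltW (archi_boundP (normr_ge0 q)).
apply: (convex_le (convex_nat (Num.bound `|q|))); rewrite [`|_%:R|]ger0_norm ?ler0n //.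
by rewrite -ratr_norm -(ratr_nat F) ler_rat.
Qed.

(** [asym x y]: the elements [x] and [y] have the same valuation, that is, they
    differ by a unit of [O]. The only element equivalent to 0 is 0. *)
Definition asym x y := exists u, [/\ u != 0, O u, O u^-1 & x = u * y].

Lemma asym_refl x : asym x x.
Proof. by exists 1; rewrite oner_neq0 invr1 mul1r. Qed.

Lemma asym_sym x y : asym x y -> asym y x.
Proof.
move=> [u [u0 Ou OVu ->]]; exists u^-1.
by rewrite invr_eq0 invrK mulKf.
Qed.

Lemma asym_trans y x z : asym x y -> asym y z -> asym x z.
Proof.
move=> [u [u0 Ou OVu ->]] [w [w0 Ow OVw ->]]; exists (u * w).
by rewrite mulf_neq0 // invfM mulrA; split=> //; exact: OM.
Qed.

Lemma asym_scale q x : q != 0 -> asym (ratr q * x) x.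
Proof.
move=> q0; exists (ratr q); split=> //; first by rewrite fmorph_eq0.
  exact: convex_ratr.
by rewrite -fmorphV; exact: convex_ratr.
Qed.

Lemma asym_O x y : asym x y -> O x -> O y.
Proof.
by move=> /asym_sym[u [_ Ou _ ->]] Ox; apply: OM.
Qed.

Lemma asym_N x y : asym x y -> asym (- x) y.
Proof.
move=> [u [u0 Ou OVu ->]]; exists (- u); rewrite oppr_eq0 invrN mulNr.
by split=> //; exact: convex_N.
Qed.

Lemma asym_norm x y : asym x y -> asym `|x| y.
Proof. by case: (ger0P x) => // _; exact: asym_N. Qed.

(** If [x] is infinitesimal relatively to [y], then [x + y] has the valuation
    of [y]. *)
Lemma asym_add_dom x y : y != 0 -> O (x / y) -> ~ O (y / x) -> asym (x + y) y.
Proof.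
move=> y0 Oxy nOyx; set u := x / y.
(* the inverse of [u] would otherwise be at most 2 in absolute value *)
have u_small : `|u| < 1 / 2%:R.
  rewrite ltNge; apply/negP => le_u; apply: nOyx.
  have -> : y / x = u^-1 by rewrite invf_div.
  apply: (convex_le (convex_nat 2)); rewrite normfV [`|2%:R|]ger0_norm ?ler0n //.
  rewrite -[leRHS]invrK lef_pV2 ?posrE ?invr_gt0 ?ltr0n //; last by lra.
  by move: le_u; rewrite div1r.
move: u_small; rewrite ltr_norml => /andP[u1 u2].
have up : 0 < u + 1 by lra.
exists (u + 1); split; first by rewrite gt_eqF.
- exact: convex_D.
- apply: (convex_le (convex_nat 2)); rewrite normfV !gtr0_norm // ?ltr0n //.
  by rewrite -[leRHS]invrK lef_pV2 ?posrE ?invr_gt0 ?ltr0n //; lra.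
- by rewrite mulrDl mul1r mulfVK.
Qed.

Lemma convex_div_total x y : O (x / y) \/ O (y / x).
Proof.
have Oinv z : O z \/ O z^-1.
  have [z1|/ltW z1] := leP `|z| 1; [left|right]; apply: (convex_le O1).
    by rewrite normr1.
  by rewrite normr1 normfV invf_le1 // (lt_le_trans ltr01).
by have [] := Oinv (x / y); [left|right; rewrite -invf_div].
Qed.

(** No cancellation takes place between elements of different valuations. *)
Lemma asym_add x y : x != 0 -> y != 0 -> ~ asym x y ->
  asym (x + y) x \/ asym (x + y) y.
Proof.
move=> x0 y0 nxy.
have notboth : O (x / y) -> O (y / x) -> False.
  move=> Oxy Oyx; apply: nxy; exists (x / y); split=> //.
  - by rewrite mulf_neq0 ?invr_eq0.
  - by rewrite invf_div.
  - by rewrite mulfVK.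
have [Oxy|Oyx] := convex_div_total x y.
  by right; apply: asym_add_dom => // /(notboth Oxy).
by left; rewrite addrC; apply: asym_add_dom => // Oxy; exact: notboth.
Qed.

(** * Exponentials on a valued field *)

(** [e] is an exponential with inverse [l] on the positive elements; no
    differentiability is assumed. *)
Section Exponential.
Context (e l : F -> F).
Context (eD : forall x y, e (x + y) = e x * e y) (e_gt0 : forall x, 0 < e x).
Context (e_mono : {mono e : x y / x < y}) (lK : forall y, 0 < y -> e (l y) = y).
Context (Oe : forall x, O x -> O (e x)).

Lemma exp_neq0 x : e x != 0. Proof. by rewrite gt_eqF. Qed.

Lemma exp0 : e 0 = 1.
Proof. by apply: (mulfI (exp_neq0 0)); rewrite -eD addr0 mulr1. Qed.

Lemma expN x : e (- x) = (e x)^-1.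
Proof. by apply: (mulfI (exp_neq0 x)); rewrite -eD subrr exp0 mulfV ?exp_neq0. Qed.

Lemma exp_gt1 x : (1 < e x) = (0 < x).
Proof. by rewrite -exp0 e_mono. Qed.

Lemma exp_inj : injective e.
Proof.
move=> x y exy; have [h|h|//] := ltgtP x y; move: h; rewrite -e_mono exy;
  by rewrite ltxx.
Qed.

Lemma exp_asym1 x : O x -> asym (e x) 1.
Proof.
move=> Ox; exists (e x); rewrite exp_neq0 mulr1 -expN.
by split=> //; apply: Oe => //; exact: convex_N.
Qed.

Lemma exp_asym x y : O (x - y) -> asym (e x) (e y).
Proof.
move=> /exp_asym1[u [u0 Ou OVu]]; rewrite mulr1 => ue.
by exists u; split=> //; rewrite -ue -eD subrK.
Qed.

(** * Separating the natural numbers by means of monomials *)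

Section Cut.
Context (G : set F) (m : F).
Context (G1 : G 1) (GM : forall x y, G x -> G y -> G (x * y)).
Context (GV : forall x y, G x -> x * y = 1 -> G y).
Context (G_inj : forall x, G x -> asym x 1 -> x = 1).
Context (Gm : G m) (m1 : 1 < m) (Ge : forall x, G x -> 1 < x -> G (e x)).

(** [(X^a - 1) / (X - 1)] for [X = e m], where [X^a] is [e (a * m)]. *)
Definition geom_sum a := (e (a * m) - 1) / (e m - 1).

(** The elements [a] for which [X^a] is a monomial and the geometric sum minus
    1 is the logarithm of a monomial. The value 0 is treated apart, since the
    geometric sum is then empty. *)
Definition nat_cut : set F :=
  [set a | a = 0 \/ [/\ 0 < a, G (e (a * m)) & G (e (geom_sum a - 1))]].

Lemma cut_m_gt0 : 0 < m. Proof. exact: lt_trans m1. Qed.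

Lemma cut_em_gt1 : 0 < e m - 1.
Proof. by rewrite subr_gt0 exp_gt1 cut_m_gt0. Qed.

Lemma geom_sumS a : geom_sum (a + 1) = e (a * m) + geom_sum a.
Proof.
have h := cut_em_gt1; rewrite /geom_sum (_ : (a + 1) * m = a * m + m); last by ring.
rewrite eD.
by field; rewrite gt_eqF.
Qed.

Lemma nat_cut_nat n : nat_cut n%:R.
Proof.
case: n => [|n]; first by left.
have Gen k : G (e (k%:R * m)).
  elim: k => [|k IH]; first by rewrite mul0r exp0.
  by rewrite -natr1 mulrDl mul1r eD; apply: GM => //; exact: Ge.
right; split; [by rewrite ltr0n|exact: Gen|].
elim: n => [|n IH].
  by rewrite /geom_sum mul1r mulfV ?subrr ?exp0 // gt_eqF // cut_em_gt1.
rewrite -natr1 geom_sumS -addrA eD; apply: GM => //.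
by apply: Ge => //; rewrite exp_gt1 mulr_gt0 ?ltr0n ?cut_m_gt0.
Qed.

(** Once the powers [X^(a-1)], ..., [X^(a-n)], which are logarithms of monomials,
    are removed from the geometric sum, an element of the interval (0, 1) is
    left; minus 1 it is a nonzero element of [O], hence not the logarithm of a
    monomial. *)
Lemma nat_cut_gap n a : n%:R < a -> a < n%:R + 1 -> ~ nat_cut a.
Proof.
move=> na an [a0|[]]; first by move: na; rewrite a0 ltrn0.
elim: n a na an => [|n IH] a na an a0 Gea Gg.
  have mg0 := cut_m_gt0; have em := cut_em_gt1.
  have e1 : 1 < e (a * m) by rewrite exp_gt1 mulr_gt0.
  have e2 : e (a * m) < e m.
    by rewrite e_mono -[ltRHS]mul1r ltr_pM2r //; move: an; rewrite add0r.
  have g0 : 0 < geom_sum a by rewrite divr_gt0 // subr_gt0.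
  have g1 : geom_sum a < 1 by rewrite ltr_pdivrMr // mul1r; lra.
  have Og : O (geom_sum a - 1).
    by apply: (convex_le O1); rewrite normr1 ler_norml; lra.
  have /eqP := exp_inj (etrans (G_inj Gg (exp_asym1 Og)) (esym exp0)).
  by rewrite subr_eq0 lt_eqF.
rewrite -natr1 in na an.
have aE : a = (a - 1) + 1 by ring.
have a1 : 0 < a - 1 by have : 0 <= n%:R :> F := ler0n _ _; lra.
have Gea1 : G (e ((a - 1) * m)).
  have -> : e ((a - 1) * m) = e (a * m) * e (- m) by rewrite -eD; congr e; ring.
  apply: GM => //; apply: (@GV (e m)); first exact: Ge.
  by rewrite -eD subrr exp0.
apply: (IH (a - 1)) => //; [lra|lra|].
have -> : geom_sum (a - 1) - 1 = (geom_sum a - 1) + - e ((a - 1) * m).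
  by rewrite {2}aE geom_sumS; ring.
rewrite eD; apply: GM => //; apply: (@GV (e (e ((a - 1) * m)))).
  by apply: Ge => //; rewrite exp_gt1 mulr_gt0 ?cut_m_gt0.
by rewrite -eD subrr exp0.
Qed.

Lemma nat_cut_gt a : nat_cut a -> (forall n, a <> n%:R) -> forall n, n%:R < a.
Proof.
move=> ca na; elim=> [|n IH].
  by have [a0|[]//] := ca; case: (na 0%N).
rewrite ltNge; apply/negP; rewrite le_eqVlt => /orP[/eqP/na//|].
by rewrite -natr1 => an; exact: (nat_cut_gap IH an).
Qed.

End Cut.

(** * Logarithms of monomials *)

Section Growth.
Context (e_growth : forall x, 0 < x -> 1 + x / 2%:R <= e x).

Lemma convex_of_exp x : O (e x) -> 0 < x -> O x.
Proof.
move=> Oex x0; apply: (convex_le (OM (convex_nat 2) Oex)).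
rewrite normrM ger0_norm ?ler0n // !gtr0_norm //.
by have := e_growth x0; lra.
Qed.

Lemma asym_exp_sub x y : asym (e x) (e y) -> O (x - y).
Proof.
move=> [u [_ Ou OVu exy]].
have ue : u = e (x - y) by rewrite eD expN exy mulfK ?exp_neq0.
have [h|h|->] := ltgtP (x - y) 0; last exact: convex_0.
  by rewrite -(opprK (x - y)); apply/convex_N/convex_of_exp; rewrite ?oppr_gt0// expN -ue.
by apply: convex_of_exp; rewrite // -ue.
Qed.

(** The logarithm of an infinitely large [a] is infinitesimal relatively to
    [a]. *)
Lemma log_prec a : 0 < a -> ~ O a -> 0 < l a /\ ~ O (a / l a).
Proof.
move=> a0 nOa.
have a1 : 1 < a.
  rewrite ltNge; apply/negP => a1; apply: nOa; apply: (convex_le O1).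
  by rewrite normr1 gtr0_norm.
have la0 : 0 < l a by rewrite -exp_gt1 lK.
split=> // Oq.
have nOl : ~ O (l a) by move=> /Oe; rewrite lK.
(* [a] is the square of [e (l a / 2)], which is at least [l a / 4] *)
have l4 : 0 < l a / 2%:R by rewrite divr_gt0 ?ltr0n.
have := e_growth l4; set t := e _ => ht.
have aE : a = t * t by rewrite -eD -splitr lK.
have t4 : l a / 4%:R <= t by lra.
apply: nOl; apply: (convex_le (OM (convex_nat 16) Oq)).
rewrite normrM ger0_norm ?ler0n // !gtr0_norm ?divr_gt0 //.
rewrite mulrA ler_pdivlMr // {3}aE.
have : (l a / 4%:R) * (l a / 4%:R) <= t * t by apply: ler_pM => //; lra.
by lra.
Qed.

Lemma exp_notin u : 0 < u -> ~ O u -> ~ O (e u).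
Proof. by move=> u0 nOu Oeu; apply: nOu; exact: convex_of_exp. Qed.

(** A subset closed under rational linear combinations. *)
Definition qspace (W : set F) := forall q x y, W x -> W y -> W (ratr q * x + y).

(** The subspaces to which the maximality argument is applied: [W] meets [O]
    only in 0, and every nonzero element of [W] has the same valuation as an
    element [e u] of [W] whose logarithm [u] is in [W] too. The empty set is
    allowed, so that the union of an empty chain need not be treated apart. *)
Definition log_space (W : set F) :=
  [/\ qspace W, forall x, W x -> O x -> x = 0
    & forall x, W x -> x != 0 -> exists u, [/\ W u, W (e u) & asym (e u) x]].

(** The subspace generated by [W] and [a]. *)
Definition adjoin (W : set F) (a : F) : set F :=
  [set x | exists q y, W y /\ x = ratr q * a + y].

Lemma qspace0 W x : qspace W -> W x -> W 0.
Proof.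
by move=> qW Wx; have := qW (-1) x x Wx Wx; rewrite rmorphN1 mulN1r addNr.
Qed.

Lemma qspaceZ W q x : qspace W -> W x -> W (ratr q * x).
Proof.
by move=> qW Wx; rewrite -[_ * _]addr0; apply: (qW) => //; exact: (qspace0 qW Wx).
Qed.

Lemma qspaceD W x y : qspace W -> W x -> W y -> W (x + y).
Proof. by move=> qW Wx Wy; rewrite -[x]mul1r -(rmorph1 (@ratr F)); exact: qW. Qed.

Lemma qspaceN W x : qspace W -> W x -> W (- x).
Proof. by move=> qW Wx; rewrite -mulN1r -(rmorphN1 (@ratr F)); exact: qspaceZ. Qed.

Lemma qspaceB W x y : qspace W -> W x -> W y -> W (x - y).
Proof. by move=> qW Wx Wy; apply: qspaceD => //; exact: qspaceN. Qed.

Lemma adjoin_qspace W a : qspace W -> qspace (adjoin W a).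
Proof.
move=> qW q x y [qx [x' [Wx ->]]] [qy [y' [Wy ->]]].
exists (q * qx + qy), (ratr q * x' + y'); split; first exact: qW.
by rewrite rmorphD rmorphM /=; ring.
Qed.

Lemma sub_adjoin W a : W `<=` adjoin W a.
Proof. by move=> x Wx; exists 0, x; rewrite rmorph0 mul0r add0r. Qed.

Lemma adjoin_gen W a : W 0 -> adjoin W a a.
Proof. by move=> W0; exists 1, 0; rewrite rmorph1 mul1r addr0. Qed.

(** If [a] has a valuation which does not occur in [W], adjoining [a] adds no
    other valuation. *)
Lemma adjoin_asym W a x : a != 0 ->
  (forall y, W y -> y != 0 -> ~ asym y a) -> adjoin W a x -> x != 0 ->
  (exists y, [/\ W y, y != 0 & asym y x]) \/ asym x a.
Proof.
move=> a0 Wa [q [y [Wy ->]]].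
have [->|q0] := eqVneq q 0.
  by rewrite rmorph0 mul0r add0r => y0; left; exists y; split=> //; exact: asym_refl.
have [-> _|y0 xy0] := eqVneq y 0; first by rewrite addr0; right; exact: asym_scale.
have qa0 : ratr q * a != 0 by rewrite mulf_neq0 ?fmorph_eq0.
have [|h|h] := asym_add qa0 y0; last 2 first.
- by right; apply: asym_trans h _; exact: asym_scale.
- by left; exists y; split=> //; exact: asym_sym.
move=> /asym_sym h; apply: (Wa y) => //.
by apply: asym_trans h _; exact: asym_scale.
Qed.

(** Adjoining a new exponential. *)
Lemma adjoin_exp W u : log_space W -> W u -> 0 < u -> ~ W (e u) ->
  log_space (adjoin W (e u)).
Proof.
move=> [qW WO We] Wu u0 nWe.
have nOu : ~ O u by move=> /(WO _ Wu) uE; rewrite uE ltxx in u0.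
have Wne y : W y -> y != 0 -> ~ asym y (e u).
  move=> Wy y0 yu; have [u' [Wu' Weu' u'y]] := We y Wy y0.
  apply: nWe; suff <- : u' = u by [].
  apply/eqP; rewrite -subr_eq0; apply/eqP/WO; first exact: qspaceB.
  by apply: asym_exp_sub; exact: asym_trans u'y yu.
have aP x : adjoin W (e u) x -> x != 0 -> 
    exists u', [/\ adjoin W (e u) u', adjoin W (e u) (e u'), asym (e u') x & ~ O x].
  move=> ax x0; have [[y [Wy y0 yx]]|xeu] := adjoin_asym (exp_neq0 u) Wne ax x0.
    have [u' [Wu' Weu' u'y]] := We y Wy y0.
    exists u'; split; [exact: sub_adjoin|exact: sub_adjoin|exact: asym_trans yx|].
    by move=> /(asym_O (asym_sym yx))/(WO _ Wy)/eqP; rewrite (negPf y0).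
  exists u; split; [exact: sub_adjoin|apply: adjoin_gen; exact: (qspace0 qW Wu)|exact: asym_sym|].
  by move=> /(asym_O xeu); exact: exp_notin.
split; first exact: adjoin_qspace.
  move=> x ax Ox; apply/eqP; apply/negPn/negP => x0.
  by have [u' [_ _ _]] := aP _ ax x0.
by move=> x ax x0; have [u' [h1 h2 h3 _]] := aP _ ax x0; exists u'.
Qed.

(** Adjoining an element [w] all of whose translates by elements of [W] are
    outside [O] and have the valuation of some [e u] with [u] in [W]. *)
Lemma adjoin_immediate W w : log_space W ->
    (forall u, W u -> 0 < u -> W (e u)) ->
    (forall x, W x -> ~ O (w - x)) ->
    (forall x, W x -> exists2 u, W u & asym (e u) (w - x)) ->
  log_space (adjoin W w).
Proof.
move=> [qW WO We] Wexp wO wim.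
have aP x : adjoin W w x -> x != 0 -> exists u, [/\ W u, W (e u), asym (e u) x & ~ O x].
  move=> [q [y [Wy ->]]]; have [->|q0] := eqVneq q 0.
    rewrite rmorph0 mul0r add0r => y0; have [u [Wu Weu uy]] := We y Wy y0.
    by exists u; split=> // /(WO _ Wy)/eqP; rewrite (negPf y0).
  move=> _; pose y' := ratr (- q^-1) * y.
  have Wy' : W y' by exact: qspaceZ.
  have xE : ratr q * w + y = ratr q * (w - y').
    rewrite /y' rmorphN fmorphV /= mulrBr mulNr mulrN opprK mulrA mulfV ?mul1r //.
    by rewrite fmorph_eq0.
  have as1 := asym_scale (w - y') q0; rewrite -xE in as1.
  have nO := wO _ Wy'.
  have [u Wu uw] := wim _ Wy'.
  exists u; split=> //.
  - apply: Wexp => //; rewrite ltNge; apply/negP => u0.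
    apply: nO; apply: asym_O uw _; apply: (convex_le O1).
    by rewrite normr1 gtr0_norm // leNgt exp_gt1 -leNgt.
  - exact: asym_trans uw (asym_sym as1).
  - by move=> /(asym_O as1).
split; first exact: adjoin_qspace.
  move=> x ax Ox; apply/eqP; apply/negPn/negP => x0.
  by have [u' [_ _ _]] := aP _ ax x0.
move=> x ax x0; have [u' [h1 h2 h3 _]] := aP _ ax x0.
by exists u'; split=> //; exact: sub_adjoin.
Qed.

(** The subspace generated by [W] and the first [n] terms of [a]. *)
Fixpoint adjoin_seq (W : set F) (a : nat -> F) n : set F :=
  if n is m.+1 then adjoin (adjoin_seq W a m) (a m) else W.

Lemma adjoin_seq_qspace W a n : qspace W -> qspace (adjoin_seq W a n).
Proof. by move=> qW; elim: n => //= n IH; exact: adjoin_qspace. Qed.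

Lemma adjoin_seq_mono W a m n : (m <= n)%N -> adjoin_seq W a m `<=` adjoin_seq W a n.
Proof.
elim: n => [|n IH]; first by rewrite leqn0 => /eqP->.
rewrite leq_eqVlt => /orP[/eqP->//|/IH h].
by apply: subset_trans h _; exact: sub_adjoin.
Qed.

(** Adjoining a chain of iterated logarithms (taken modulo [W]) none of which
    has the valuation of an element of [e @` W]. *)
Lemma adjoin_chain W (a b : nat -> F) : log_space W -> W 0 ->
    (forall n, [/\ 0 < a n, ~ O (a n) & forall u, W u -> ~ asym (e u) (a n)]) ->
    (forall n, W (b n)) -> (forall n, a n.+1 = `|l (a n) - b n|) ->
  log_space (\bigcup_n adjoin_seq W a n).
Proof.
move=> [qW WO We] W0 aP Wb aS; set U := \bigcup_n _.
have a_gt0 n : 0 < a n by have [] := aP n.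
have nOa n : ~ O (a n) by have [] := aP n.
have Wa n y : W y -> y != 0 -> ~ asym y (a n).
  move=> Wy y0 ya; have [_ _ h] := aP n; have [u [Wu _ uy]] := We _ Wy y0.
  by apply: (h u Wu); exact: asym_trans uy ya.
(* otherwise [b n], the difference of [l (a n)] and of [a n.+1] up to sign,
   has the valuation of [a n.+1], which does not occur in [W] *)
have aS_le n : O (a n.+1 / l (a n)).
  have [la0 _] := log_prec (a_gt0 n) (nOa n).
  apply: contrapT => nOd.
  have Oinv : O (l (a n) / a n.+1) by have [] := convex_div_total (a n.+1) (l (a n)).
  have a0 : - (l (a n) - b n) != 0.
    by rewrite oppr_eq0 -normr_eq0 -aS gt_eqF.
  have as1 : asym (- (l (a n) - b n)) (a n.+1).
    by apply: asym_N; rewrite aS; apply: asym_sym; apply: asym_norm; exact: asym_refl.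
  have nsame : ~ asym (l (a n)) (- (l (a n) - b n)).
    move=> h; apply: nOd; have [u [u0 Ou OVu ->]] := asym_sym (asym_trans h as1).
    by rewrite mulfK // gt_eqF.
  have bE : l (a n) + - (l (a n) - b n) = b n by ring.
  have b_as : asym (b n) (a n.+1).
    rewrite -bE; have [h|h] := asym_add (lt0r_neq0 la0) a0 nsame; last exact: asym_trans h as1.
    apply: asym_trans (asym_add_dom _ _ _) (as1) => //.
      have [u [u0 Ou OVu ->]] := as1; rewrite invfM mulrCA.
      exact: OM.
    move=> Oy; apply: nOd; have [u [u0 Ou OVu aE]] := asym_sym as1.
    by rewrite aE -mulrA; exact: OM.
  apply: (Wa n.+1 _ (Wb n)) b_as; apply/eqP => b0; move: nsame; rewrite b0 subr0; apply.
  by apply: asym_sym; apply: asym_N; exact: asym_refl.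
(* [a n.+1] is at most of the order of [l (a n)], which is negligible with
   respect to [a n] *)
have aS_prec n : ~ O (a n / a n.+1).
  have [la0 nOl] := log_prec (a_gt0 n) (nOa n); move=> Oq; apply: nOl.
  have := OM Oq (aS_le n); rewrite mulrA mulfVK //.
  by rewrite gt_eqF.
have aS_lt n : a n.+1 < a n.
  rewrite ltNge; apply/negP => h; apply: (aS_prec n); apply: (convex_le O1).
  by rewrite normr1 gtr0_norm ?divr_gt0 // ler_pdivrMr ?mul1r.
have a_dec i j : (i < j)%N -> a j <= a i.+1.
  elim: j => // j IH; rewrite ltnS leq_eqVlt => /orP[/eqP->//|/IH].
  by apply: le_trans; exact: ltW.
have a_ne i j : (i < j)%N -> ~ asym (a i) (a j).
  move=> ij [u [u0 Ou OVu aE]]; apply: (aS_prec i).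
  apply: (convex_le Ou); have -> : u = a i / a j by rewrite aE mulfK ?gt_eqF.
  rewrite !gtr0_norm ?divr_gt0 //.
  by rewrite ler_pM2l // lef_pV2 ?posrE //; exact: a_dec.
have key n x : adjoin_seq W a n x -> x != 0 ->
    (exists y, [/\ W y, y != 0 & asym y x]) \/ exists2 i, (i < n)%N & asym (a i) x.
  elim: n x => [|n IH] x /= Wx x0.
    by left; exists x; split=> //; exact: asym_refl.
  have [| |[y [Wy y0 yx]]|xa] := adjoin_asym _ _ Wx x0.
  - by rewrite gt_eqF.
  - move=> y Wy y0 ya; have [[z [Wz z0 zy]]|[i lt_in ay]] := IH y Wy y0.
      by apply: (Wa n z) => //; exact: asym_trans ya.
    by apply: (a_ne i n) => //; exact: asym_trans ya.
  - have [[z [Wz z0 zy]]|[i lt_in ay]] := IH y Wy y0.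
      by left; exists z; split=> //; exact: asym_trans yx.
    by right; exists i; [exact: ltnW|exact: asym_trans yx].
  - by right; exists n => //; exact: asym_sym.
have qU : qspace U.
  move=> q x y [m _ mx] [n _ ny]; exists (maxn m n) => //.
  apply: adjoin_seq_qspace => //; apply: adjoin_seq_mono mx || apply: adjoin_seq_mono ny.
    exact: leq_maxl.
  exact: leq_maxr.
have WU : W `<=` U by move=> x Wx; exists 0%N.
have Ua n : U (a n).
  exists n.+1 => //=; apply: adjoin_gen; apply: (@adjoin_seq_mono _ _ 0) => //.
have Ula n : U (l (a n)).
  have -> : l (a n) = (l (a n) - b n) + b n by ring.
  apply: qspaceD => //; last exact: WU.
  have := Ua n.+1; rewrite aS; case: (ger0P (l (a n) - b n)) => // _.
  by move=> /(qspaceN qU); rewrite opprK.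
have UP x : U x -> x != 0 -> exists u, [/\ U u, U (e u), asym (e u) x & ~ O x].
  move=> [n _ nx] x0; have [[y [Wy y0 yx]]|[i _ ax]] := key n x nx x0.
    have [u [Wu Weu uy]] := We y Wy y0.
    exists u; split; [exact: WU|exact: WU|exact: asym_trans yx|].
    by move=> /(asym_O (asym_sym yx))/(WO _ Wy)/eqP; rewrite (negPf y0).
  exists (l (a i)); rewrite lK //; split=> //.
  by move=> Ox; exact: (nOa i (asym_O (asym_sym ax) Ox)).
split=> //.
  move=> x ax Ox; apply/eqP; apply/negPn/negP => x0.
  by have [u' [_ _ _]] := UP _ ax x0.
by move=> x ax x0; have [u' [h1 h2 h3 _]] := UP _ ax x0; exists u'.
Qed.

Lemma log_space0 : log_space [set 0].
Proof.
split=> //; first by move=> q x y -> ->; rewrite mulr0 addr0.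
by move=> x ->; rewrite eqxx.
Qed.

Lemma log_space_bigcup (C : set (set F)) :
  C `<=` log_space -> total_on C subset -> log_space (\bigcup_(X in C) X).
Proof.
move=> CP Ct; split.
- move=> q x y [X CX Xx] [Y CY Yy].
  have [XY|YX] := Ct _ _ CX CY.
    by exists Y => //; have [qY _ _] := CP _ CY; apply: qY => //; exact: XY.
  by exists X => //; have [qX _ _] := CP _ CX; apply: qX => //; exact: YX.
- by move=> x [X CX Xx]; have [_ h _] := CP _ CX; exact: h.
- move=> x [X CX Xx] x0; have [_ _ h] := CP _ CX; have [u [Xu Xeu ux]] := h x Xx x0.
  by exists u; split=> //; exists X.
Qed.

(** The logarithms of a compatible monomial group: a complement of [O] stable
    under [e] on its positive elements. *)
Lemma exists_log_space : exists L : set F,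
  [/\ qspace L, forall x, L x -> O x -> x = 0,
      forall u, L u -> 0 < u -> L (e u)
    & forall x, exists2 y, L y & O (x - y)].
Proof.
have [L [LP Lmax]] := Zorn_bigcup log_space_bigcup.
have L0 : L 0.
  have [[x Lx]|h] := pselect (exists x, L x).
    by have [qL _ _] := LP; exact: (qspace0 qL Lx).
  exfalso; apply: (Lmax [set 0]); last exact: log_space0.
  split; first by move=> x Lx; case: h; exists x.
  by move=> /(_ 0 erefl) L0; apply: h; exists 0.
have ext W a : log_space W -> L `<=` W -> W a -> ~ L a -> False.
  move=> WP LW Wa nLa; apply: (Lmax W) => //; split=> // WL.
  by apply: nLa; exact: WL.
have Lexp u : L u -> 0 < u -> L (e u).
  move=> Lu u0; apply: contrapT => nLe.
  apply: (ext _ (e u) (adjoin_exp LP Lu u0 nLe)) => //; first exact: sub_adjoin.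
  exact: adjoin_gen.
have [qL LO Le] := LP; exists L; split=> // w.
apply: contrapT => nw.
(* otherwise [z] could be adjoined *)
have step z : (forall y, L y -> ~ O (z - y)) ->
    exists2 b, L b & forall u, L u -> ~ asym (e u) `|z - b|.
  move=> nz; apply: contrapT => h.
  apply: (ext (adjoin L z) z); last 2 first.
  - exact: adjoin_gen.
  - by move=> Lz; apply: (nz z) => //; rewrite subrr; exact: convex_0.
  - apply: adjoin_immediate => // x Lx; apply: contrapT => h1; apply: h.
    exists x => // u Lu /asym_sym h2; apply: h1; exists u => //.
    apply: asym_sym; apply: asym_trans h2.
    by apply: asym_sym; apply: asym_norm; exact: asym_refl.
  - exact: sub_adjoin.
(* the elements which can occur in the chain of iterated logarithms *)
pose St a := [/\ 0 < a, ~ O a & forall u, L u -> ~ asym (e u) a].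
have St_l a : St a -> forall y, L y -> ~ O (l a - y).
  move=> [a0 nOa ha] y Ly /(exp_asym)/asym_sym; rewrite lK //.
  exact: ha.
have St_next z : (forall y, L y -> ~ O (z - y)) -> exists2 b, L b & St `|z - b|.
  move=> nz; have [b Lb hb] := step z nz; exists b => //; split=> //.
    rewrite normr_gt0; apply/eqP => zb; apply: (nz b Lb); rewrite zb; exact: convex_0.
  by move=> /convex_norm; exact: nz.
have [b0 Lb0 St0] : exists2 b, L b & St `|w - b|.
  by apply: St_next => y Ly Oy; apply: nw; exists y.
have /choice[f fP] : forall a, exists b, St a -> L b /\ St `|l a - b|.
  move=> a; have [Sa|nSa] := pselect (St a); last by exists 0.
  by have [b Lb Sb] := St_next _ (St_l _ Sa); exists b.
pose a := fix a n := if n is m.+1 then `|l (a m) - f (a m)| else `|w - b0|.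
have Sa n : St (a n) by elim: n => //= n /fP[].
apply: (ext (\bigcup_n adjoin_seq L a n) (a 0%N)).
- apply: (@adjoin_chain _ _ (fun n => f (a n))) => // n.
  by have [] := fP _ (Sa n).
- by move=> x Lx; exists 0%N.
- by exists 1%N => //=; exact: adjoin_gen.
- move=> La; have [a0 _ ha] := Sa 0%N.
  have [u [Lu _ ua]] := Le _ La (lt0r_neq0 a0).
  exact: (ha u).
Qed.

(** A compatible monomial group, as a set of representatives of the nonzero
    elements up to units of [O]. *)
Lemma exists_monomials : exists G : set F,
  [/\ forall x, G x -> 0 < x, G 1, forall x y, G x -> G y -> G (x * y)
    & forall x, G x -> G x^-1] /\
  [/\ forall x y, G x -> G y -> asym x y -> x = y,
      forall x, x != 0 -> exists2 g, G g & asym g x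
    & forall x, G x -> 1 < x -> G (e x)].
Proof.
have [L [qL LO Le Lc]] := exists_log_space.
have L0 : L 0 by have [y Ly _] := Lc 0; exact: (qspace0 qL Ly).
exists (e @` L); split; split.
- by move=> _ [x _ <-].
- by exists 0 => //; exact: exp0.
- by move=> _ _ [x Lx <-] [y Ly <-]; exists (x + y); [exact: qspaceD|exact: eD].
- by move=> _ [x Lx <-]; exists (- x); [exact: qspaceN|exact: expN].
- move=> _ _ [x Lx <-] [y Ly <-] /asym_exp_sub Oxy; congr e.
  by apply/eqP; rewrite -subr_eq0; apply/eqP/LO => //; exact: qspaceB.
- move=> x x0; have [y Ly Oxy] := Lc (l `|x|).
  exists (e y); first by exists y.
  apply: asym_trans (asym_sym (exp_asym Oxy)) _.
  by rewrite lK ?normr_gt0 //; apply: asym_norm; exact: asym_refl.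
- by move=> _ [x Lx <-]; rewrite exp_gt1 => x0; exists (e x) => //; exact: Le.
Qed.

End Growth.
End Exponential.
End ConvexSubring.

(** * Substitution, expansions of the language, and definability *)

(** The environment extending [e] by [x] as value of the variable 0. *)
Definition scons (X : Type) (x : X) (e : nat -> X) : nat -> X :=
  fun k => if k is k'.+1 then e k' else x.

Lemma vcons0 (X : Type) n (x : X) (v : 'I_n -> X) : vcons x v ord0 = x.
Proof. by rewrite /vcons unlift_none. Qed.

Lemma vcons_lift (X : Type) n (x : X) (v : 'I_n -> X) i :
  vcons x v (lift ord0 i) = v i.
Proof. by rewrite /vcons liftK. Qed.

Lemma vconsP (X : Type) n (x : X) (v : 'I_n -> X) (w : 'I_n.+1 -> X) :
  w ord0 = x -> (forall i, w (lift ord0 i) = v i) -> vcons x v = w.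
Proof.
move=> w0 wl; apply/funext => i; case: (unliftP ord0 i) => [j ->|->].
  by rewrite vcons_lift wl.
by rewrite vcons0 w0.
Qed.

Lemma vcons_comp (X Y : Type) (h : X -> Y) n (x : X) (v : 'I_n -> X) :
  vcons (h x) (fun i => h (v i)) = fun i => h (vcons x v i).
Proof. by apply: vconsP => [|i]; rewrite ?vcons0 ?vcons_lift. Qed.

Lemma vcons_scons (X : Type) n (x : X) (e : nat -> X) :
  vcons x (fun i : 'I_n => e i) = fun i : 'I_n.+1 => scons x e i.
Proof. exact: vconsP. Qed.

Section Substitution.
Context {L : language}.

(** Substitution of terms for the variables of a term; [slift] moves a
    substitution under a quantifier, and [fsubst] acts on formulas. *)
Fixpoint tsubst n m (s : 'I_n -> term L m) (t : term L n) : term L m :=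
  match t with
  | Var i => s i
  | App f a => App (fun i => tsubst s (a i))
  end.

Definition slift n m (s : 'I_n -> term L m) : 'I_n.+1 -> term L m.+1 :=
  vcons (Var L ord0) (fun i => tsubst (fun j => Var L (lift ord0 j)) (s i)).

Fixpoint fsubst n (p : formula L n) : forall m, ('I_n -> term L m) -> formula L m :=
  match p with
  | Equal t u => fun m s => Equal (tsubst s t) (tsubst s u)
  | Rel r a => fun m s => Rel (fun i => tsubst s (a i))
  | Bot => fun m s => Bot L m
  | Imp p q => fun m s => Imp (fsubst p s) (fsubst q s)
  | All p => fun m s => All (fsubst p (slift s))
  end.

Lemma eval_tsubst (M : structure L) n m (s : 'I_n -> term L m) (v : 'I_m -> M) t :
  eval v (tsubst s t) = eval (fun i => eval v (s i)) t.
Proof. by elim: t => //= f a IH; congr finterp; apply/funext. Qed.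

Lemma sat_fsubst (M : structure L) n (p : formula L n) m (s : 'I_n -> term L m)
    (v : 'I_m -> M) :
  sat (fsubst p s) v <-> sat p (fun i => eval v (s i)).
Proof.
elim: p m s v => {n} /= [n t u|n r a|n|n p IHp q IHq|n p IHp] m s v //.
- by rewrite !eval_tsubst.
- have -> // : (fun i => eval v (tsubst s (a i))) =
    (fun i => eval (fun i => eval v (s i)) (a i)).
  by apply/funext => i; rewrite eval_tsubst.
- by rewrite IHp IHq.
- suff E x : (fun i => eval (vcons x v) (slift s i)) =
      vcons x (fun i => eval v (s i)).
    by split=> h x; have := h x; rewrite IHp E.
  symmetry; apply: vconsP => [|i]; rewrite /slift; first by rewrite vcons0 /= vcons0.
  rewrite vcons_lift eval_tsubst /=.
  by congr eval; apply/funext => j; rewrite vcons_lift.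
Qed.

End Substitution.

Section Reduct.
Context {L1 L2 : language}.

(** Terms and formulas of a language, read in an expansion. *)
Fixpoint temb n (t : term L1 n) : term (lang_sum L1 L2) n :=
  match t with
  | Var i => Var _ i
  | App f a => @App (lang_sum L1 L2) n (inl f) (fun i => temb (a i))
  end.

Fixpoint femb n (p : formula L1 n) : formula (lang_sum L1 L2) n :=
  match p with
  | Equal t u => Equal (temb t) (temb u)
  | Rel r a => @Rel (lang_sum L1 L2) _ (inl r) (fun i => temb (a i))
  | Bot => Bot _ _
  | Imp p q => Imp (femb p) (femb q)
  | All p => All (femb p)
  end.

Lemma eval_temb (M : structure (lang_sum L1 L2)) n (v : 'I_n -> M) (t : term L1 n) :
  eval v (temb t) = eval (M := reduct M) v t.
Proof. by elim: t => //= f a IH; congr finterp; apply/funext. Qed.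

Lemma sat_femb (M : structure (lang_sum L1 L2)) n (p : formula L1 n) (v : 'I_n -> M) :
  sat (femb p) v <-> sat (M := reduct M) p v.
Proof.
elim: p v => {n} /= [n t u|n r a|n|n p IHp q IHq|n p IHp] v //.
- by rewrite !eval_temb.
- have -> // : (fun i => eval v (temb (a i))) = (fun i => eval (M := reduct M) v (a i)).
  by apply/funext => i; rewrite eval_temb.
- by rewrite IHp IHq.
- by split=> h x; have := h x; rewrite IHp.
Qed.

End Reduct.

Section FirstOrder.
Context {L : language}.

(** [isterm t] and [isdef P]: the operation [t] and the property [P] of
    environments are given by a single term, a single formula in all
    structures. Environments are indexed by [nat], so that no bound on the
    variables needs to be tracked: only that all large bounds are suitable. *)
Definition isterm (t : forall M : structure L, (nat -> M) -> M) :=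
  exists N, forall n, (N <= n)%N -> exists u : term L n,
    forall (M : structure L) (e : nat -> M), t M e = eval (fun i : 'I_n => e i) u.

Definition isdef (P : forall M : structure L, (nat -> M) -> Prop) :=
  exists N, forall n, (N <= n)%N -> exists p : formula L n,
    forall (M : structure L) (e : nat -> M), P M e <-> sat p (fun i : 'I_n => e i).

Lemma isterm_var k : isterm (fun M e => e k).
Proof.
by exists k.+1 => n kn; exists (Var L (Ordinal kn)).
Qed.

Lemma isterm_choice k (a : 'I_k -> forall M : structure L, (nat -> M) -> M) :
  (forall i, isterm (a i)) ->
  exists N, forall n, (N <= n)%N -> exists u : 'I_k -> term L n,
    forall i (M : structure L) (e : nat -> M), a i M e = eval (fun i : 'I_n => e i) (u i).
Proof.
move=> /choice[N hN]; exists (\max_i N i)%N => n Nn.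
have /choice[u hu] : forall i, exists u : term L n, forall (M : structure L) (e : nat -> M),
    a i M e = eval (fun i : 'I_n => e i) u.
  by move=> i; apply: hN; apply: leq_trans Nn; exact: (leq_bigmax i).
by exists u.
Qed.

Lemma isterm_app (f : Defs.fsym L) (a : 'I_(farity f) -> forall M : structure L, (nat -> M) -> M) :
  (forall i, isterm (a i)) -> isterm (fun M e => finterp (fun i => a i M e)).
Proof.
move=> /isterm_choice[N hN]; exists N => n /hN[u hu]; exists (App u) => M e /=.
by congr finterp; apply/funext => i; rewrite hu.
Qed.

Lemma isdef_rel (r : rsym L) (a : 'I_(rarity r) -> forall M : structure L, (nat -> M) -> M) :
  (forall i, isterm (a i)) -> isdef (fun M e => rinterp (fun i => a i M e)).
Proof.
move=> /isterm_choice[N hN]; exists N => n /hN[u hu]; exists (Rel u) => M e /=.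
suff -> : (fun i => a i M e) = (fun i => eval (fun j : 'I_n => e j) (u i)) by [].
by apply/funext => i; rewrite hu.
Qed.

Lemma isdef_sat k (p : formula L k) (a : 'I_k -> forall M : structure L, (nat -> M) -> M) :
  (forall i, isterm (a i)) -> isdef (fun M e => sat p (fun i => a i M e)).
Proof.
move=> /isterm_choice[N hN]; exists N => n /hN[u hu]; exists (fsubst p u) => M e /=.
suff -> : (fun i => a i M e) = (fun i => eval (fun j : 'I_n => e j) (u i)).
  by rewrite sat_fsubst.
by apply/funext => i; rewrite hu.
Qed.

Lemma isdef_eq t u : isterm t -> isterm u -> isdef (fun M e => t M e = u M e).
Proof.
move=> [N1 h1] [N2 h2]; exists (maxn N1 N2) => n; rewrite geq_max => /andP[n1 n2].
have [t' ht] := h1 n n1; have [u' hu] := h2 n n2.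
by exists (Equal t' u') => M e /=; rewrite ht hu.
Qed.

Lemma isdef_false : isdef (fun M e => False).
Proof. by exists 0%N => n _; exists (Bot L n). Qed.

Lemma isdef_imp P Q : isdef P -> isdef Q -> isdef (fun M e => P M e -> Q M e).
Proof.
move=> [N1 h1] [N2 h2]; exists (maxn N1 N2) => n; rewrite geq_max => /andP[n1 n2].
have [p hp] := h1 n n1; have [q hq] := h2 n n2.
by exists (Imp p q) => M e /=; rewrite hp hq.
Qed.

Lemma isdef_all (Q : forall M : structure L, M -> (nat -> M) -> Prop) :
  isdef (fun M e => Q M (e 0%N) (fun k => e k.+1)) ->
  isdef (fun M e => forall x : M, Q M x e).
Proof.
move=> [N h]; exists N => n nN; have [p hp] := h n.+1 (leqW nN).
exists (All p) => M e /=; split=> hx x.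
  by rewrite vcons_scons; apply/(hp M (scons x e)); exact: hx.
by have := hx x; rewrite vcons_scons => /(hp M (scons x e)).
Qed.

Lemma isdef_iff P Q : (forall M e, P M e <-> Q M e) -> isdef P -> isdef Q.
Proof.
move=> PQ [N h]; exists N => n /h[p hp]; exists p => M e.
by rewrite -PQ.
Qed.

Lemma isdef_not P : isdef P -> isdef (fun M e => ~ P M e).
Proof. by move=> dP; apply: isdef_imp => //; exact: isdef_false. Qed.

Lemma isdef_and P Q : isdef P -> isdef Q -> isdef (fun M e => P M e /\ Q M e).
Proof.
move=> dP dQ; apply: (@isdef_iff (fun M e => ~ (P M e -> ~ Q M e))).
  by move=> M e; split=> [/not_implyP[? /contrapT]//|[p q] /(_ p)].
by apply: isdef_not; apply: isdef_imp => //; exact: isdef_not.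
Qed.

Lemma isdef_or P Q : isdef P -> isdef Q -> isdef (fun M e => P M e \/ Q M e).
Proof.
move=> dP dQ; apply: (@isdef_iff (fun M e => ~ P M e -> Q M e)).
  move=> M e; split=> [h|[p np|]//].
  by have [p|/h q] := pselect (P M e); [left|right].
by apply: isdef_imp => //; exact: isdef_not.
Qed.

Lemma isdef_ex (Q : forall M : structure L, M -> (nat -> M) -> Prop) :
  isdef (fun M e => Q M (e 0%N) (fun k => e k.+1)) ->
  isdef (fun M e => exists x : M, Q M x e).
Proof.
move=> dQ; apply: (@isdef_iff (fun M e => ~ forall x : M, ~ Q M x e)).
  move=> M e; split=> [/existsNP[x /contrapT]|[x qx] /(_ x)//].
  by exists x.
apply: isdef_not; apply: (isdef_all (Q := fun M x e => ~ Q M x e)).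
exact: isdef_not.
Qed.

Lemma definable_isdef P (M : structure L) (c : nat -> M) :
  isdef P -> definable [set x | P M (scons x c)].
Proof.
move=> [N h]; have [p hp] := h N.+1 (leqnSn N).
exists N, p, (fun i => c i); apply/seteqP.
by split=> x /=; rewrite vcons_scons hp.
Qed.

Lemma elementary_isdef P (M N : structure L) (j : M -> N) (e : nat -> M) :
  elementary j -> isdef P -> P M e <-> P N (fun k => j (e k)).
Proof. by move=> ej [n h]; have [p hp] := h n (leqnn n); rewrite !hp (ej n p). Qed.

End FirstOrder.

(** * Ultrapowers *)

Section Ultrapower.
Context {L : language} {T : Type} (U : set_system T) (UU : UltraFilter U).
Context (M : structure L) (x0 : M).

Lemma ultra_imp (A B : set T) : (U A -> U B) <-> U [set i | A i -> B i].
Proof.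
split=> [AB|h UA]; last first.
  by apply: filterS (filterI h UA) => i [/= ab a]; exact: ab.
have [/AB UB|UnA] := in_ultra_setVsetC A UU; first by apply: filterS UB => i Bi _.
by apply: filterS UnA => i nA.
Qed.

(** Equality almost everywhere. *)
Definition ueq (f g : T -> M) := U [set i | f i = g i].

Lemma ueq_refl f : ueq f f.
Proof. by apply: filterS (@filterT _ U _) => i. Qed.

Lemma ueq_sym f g : ueq f g -> ueq g f.
Proof. by apply: filterS => i /= ->. Qed.

Lemma ueq_trans f g h : ueq f g -> ueq g h -> ueq f h.
Proof. by move=> fg gh; apply: filterS (filterI fg gh) => i [/= -> ->]. Qed.

(** The elements of the ultrapower are the classes of families for equality
    almost everywhere; [upi f] is the class of [f] and [urepr] chooses a
    representative of a class. *)
Definition ucar := {C : set (T -> M) | exists f, C = [set g | ueq f g]}.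

Definition upi (f : T -> M) : ucar := exist _ _ (ex_intro _ f erefl).

Definition urepr (C : ucar) : T -> M := projT1 (cid (proj2_sig C)).

Lemma upi_eq f g : ueq f g -> upi f = upi g.
Proof.
move=> fg; apply: eq_exist; apply/seteqP; split=> h /=.
  exact/ueq_trans/ueq_sym.
exact: ueq_trans.
Qed.

Lemma ureprK C : upi (urepr C) = C.
Proof.
rewrite /urepr; case: cid => f /= fE; case: C fE => C PC /= fE.
by apply: eq_exist.
Qed.

Lemma urepr_upi f : ueq (urepr (upi f)) f.
Proof.
rewrite /urepr; case: cid => g /= /seteqP[h _].
by have := h f (ueq_refl f).
Qed.

Lemma ueq_urepr C D : ueq (urepr C) (urepr D) <-> C = D.
Proof.
split=> [/upi_eq|->]; first by rewrite !ureprK.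
exact: ueq_refl.
Qed.

(** Symbols are interpreted on representatives; functions and relations do
    not depend on them up to equality almost everywhere. *)
Definition upower : structure L :=
  @Structure L ucar
    (fun f a => upi (fun i => finterp (fun k => urepr (a k) i)))
    (fun r a => U [set i | rinterp (fun k => urepr (a k) i)]).

Lemma filter_forall_ord n (P : 'I_n -> T -> Prop) :
  (forall k, U [set i | P k i]) -> U [set i | forall k, P k i].
Proof. exact: filter_forall. Qed.

Lemma eval_upower n (v : 'I_n -> upower) (t : term L n) :
  ueq (urepr (eval v t)) (fun i => eval (fun k => urepr (v k) i) t).
Proof.
elim: t => [k|f a IH] /=; first exact: ueq_refl.
apply: ueq_trans (urepr_upi _) _.
apply: filterS (filter_forall_ord IH) => i h /=.
by congr finterp; apply/funext => k; exact: h.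
Qed.

(** Los's theorem. *)
Lemma sat_upower n (p : formula L n) (v : 'I_n -> upower) :
  sat p v <-> U [set i | sat p (fun k => urepr (v k) i)].
Proof.
elim: p v => {n} /= [n t u|n r a|n|n p IHp q IHq|n p IHp] v.
- have ht := eval_upower v t; have hu := eval_upower v u.
  split=> [/ueq_urepr tu|tu].
    exact: ueq_trans (ueq_sym ht) (ueq_trans tu hu).
  by apply/ueq_urepr; apply: ueq_trans ht (ueq_trans tu (ueq_sym hu)).
- have ha := filter_forall_ord (fun k => eval_upower v (a k)).
  split=> h; apply: filterS (filterI h ha) => i [/= hr E].
    suff <- : (fun k => urepr (eval (M := upower) v (a k)) i) =
      (fun k => eval (M := M) (fun k0 => urepr (v k0) i) (a k)) by [].
    by apply/funext => k; exact: E.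
  suff -> : (fun k => urepr (eval (M := upower) v (a k)) i) =
    (fun k => eval (M := M) (fun k0 => urepr (v k0) i) (a k)) by [].
  by apply/funext => k; exact: E.
- by split=> // /filter_ex[].
- by rewrite IHp IHq; exact: ultra_imp.
- split=> h; last first.
    move=> x; apply/IHp; apply: filterS h => i /= /(_ (urepr x i)).
    by rewrite (vcons_comp (fun y => urepr y i)).
  (* an element which is the class of a family of counterexamples *)
  pose bad i y := ~ sat p (vcons y (fun k => urepr (v k) i)).
  have /choice[f hf] : forall i, exists y, (exists z, bad i z) -> bad i y.
    move=> i; have [[z bz]|nb] := pselect (exists z, bad i z).
      by exists z.
    by exists x0.
  have := h (upi f) => /IHp sf.
  apply: filterS (filterI sf (urepr_upi f)) => i [/= + E] y.
  rewrite -(vcons_comp (fun y => urepr y i)) E => sfi.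
  by apply: contrapT => nb; apply: (hf i); first by exists y.
Qed.

(** The diagonal embedding. *)
Definition udiag (x : M) : upower := upi (fun _ => x).

Lemma elementary_udiag : elementary (M := M) (N := upower) udiag.
Proof.
move=> n p v; rewrite sat_upower.
have hv := filter_forall_ord (fun k => urepr_upi (fun=> v k)).
split=> [pv|h].
  apply: filterS hv => i /= E; suff -> : (fun k => urepr (udiag (v k)) i) = v by [].
  by apply/funext => k; exact: E.
have [i [/= + E]] := filter_ex (filterI h hv).
suff -> : (fun k => urepr (udiag (v k)) i) = v by [].
by apply/funext => k; exact: E.
Qed.

End Ultrapower.

(** * Building definable sets *)

Section Definability.
Context {L : language}.
Implicit Types (t u : forall M : structure L, (nat -> M) -> M).

Lemma isterm_nul (op : forall M : structure L, ('I_0 -> M) -> M) :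
  (forall a : 'I_0 -> forall M : structure L, (nat -> M) -> M,
    (forall i, isterm (a i)) -> isterm (fun M e => op M (fun i => a i M e))) ->
  isterm (fun M e => op M (tnth [tuple])).
Proof.
move=> h; have [[//]|N hN] := h (fun _ M e => e 0%N).
exists N => n /hN[v hv]; exists v => M e; rewrite -hv; congr op.
by apply/funext => -[].
Qed.

Lemma isterm_un (op : forall M : structure L, ('I_1 -> M) -> M) t :
  (forall a : 'I_1 -> forall M : structure L, (nat -> M) -> M,
    (forall i, isterm (a i)) -> isterm (fun M e => op M (fun i => a i M e))) ->
  isterm t -> isterm (fun M e => op M (tnth [tuple t M e])).
Proof.
move=> h dt; have [//|N hN] := h (fun _ => t).
exists N => n /hN[v hv]; exists v => M e; rewrite -hv; congr op.
by apply/funext => i; rewrite (ord1 i).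
Qed.

Lemma tnth2 (X : Type) (x y : X) :
  tnth [tuple x; y] = fun i => if i == ord0 then x else y.
Proof. by apply/funext => -[[|[|]]]. Qed.

Lemma isterm_bin (op : forall M : structure L, ('I_2 -> M) -> M) t u :
  (forall a : 'I_2 -> forall M : structure L, (nat -> M) -> M,
    (forall i, isterm (a i)) -> isterm (fun M e => op M (fun i => a i M e))) ->
  isterm t -> isterm u -> isterm (fun M e => op M (tnth [tuple t M e; u M e])).
Proof.
move=> h dt du; have [|N hN] := h (fun i => if i == ord0 then t else u).
  by move=> i; case: ifP.
exists N => n /hN[v hv]; exists v => M e; rewrite -hv tnth2; congr op.
by apply/funext => i; case: ifP.
Qed.

Lemma isdef_un (Q : forall M : structure L, ('I_1 -> M) -> Prop) t :
  (forall a : 'I_1 -> forall M : structure L, (nat -> M) -> M,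
    (forall i, isterm (a i)) -> isdef (fun M e => Q M (fun i => a i M e))) ->
  isterm t -> isdef (fun M e => Q M (tnth [tuple t M e])).
Proof.
move=> h dt; apply: isdef_iff (h (fun _ => t) (fun=> dt)) => M e.
suff -> : tnth [tuple t M e] = fun=> t M e by [].
by apply/funext => i; rewrite (ord1 i).
Qed.

Lemma isdef_bin (Q : forall M : structure L, ('I_2 -> M) -> Prop) t u :
  (forall a : 'I_2 -> forall M : structure L, (nat -> M) -> M,
    (forall i, isterm (a i)) -> isdef (fun M e => Q M (fun i => a i M e))) ->
  isterm t -> isterm u -> isdef (fun M e => Q M (tnth [tuple t M e; u M e])).
Proof.
move=> h dt du; pose a i := if i == ord0 :> 'I_2 then t else u.
have da i : isterm (a i) by rewrite /a; case: ifP.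
apply: isdef_iff (h a da) => M e; rewrite tnth2.
suff -> : (fun i => a i M e) = fun i => if i == ord0 then t M e else u M e by [].
by apply/funext => i; rewrite /a; case: ifP.
Qed.

Lemma isdef_sat2 (p : formula L 2) t u :
  isterm t -> isterm u -> isdef (fun M e => sat p (tnth [tuple t M e; u M e])).
Proof. by apply: (isdef_bin (Q := fun M => sat p)); exact: isdef_sat. Qed.

Lemma isdef_env k (p : formula L k) (r : 'I_k -> nat) :
  isdef (fun M e => sat p (fun i => e (r i))).
Proof. by apply: isdef_sat => i; exact: isterm_var. Qed.

Lemma definable_setI (M : structure L) (A B : set M) :
  definable A -> definable B -> definable (A `&` B).
Proof.
move=> [k1 [p [c ->]]] [k2 [q [d ->]]].
have [-> |[x0 _]] : ([set x | sat p (vcons x c)] `&` [set x | sat q (vcons x d)] = set0)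
    \/ exists x : M, True.
- have [[x _]|h] := pselect (exists x : M, True); first by right; exists x.
  by left; apply/seteqP; split=> // x; case: h; exists x.
- exists 0%N, (Bot L 1), (tnth [tuple]).
  by apply/seteqP; split=> x.
pose P (N : structure L) (e : nat -> N) :=
  sat p (fun i : 'I_k1.+1 => e i) /\
  sat q (fun i : 'I_k2.+1 => e (if i == 0%N :> nat then 0%N else i + k1)%N).
have dP : isdef P by apply: isdef_and; exact: isdef_env.
(* the parameters [c], then the parameters [d]; the default value is not
   used *)
pose env (n : nat) : M := if insub n is Some i then c i
  else if insub (n - k1)%N is Some i then d i else x0.
suff -> : [set x | sat p (vcons x c)] `&` [set x | sat q (vcons x d)] =
    [set x | P M (scons x env)] by exact: definable_isdef.
have E1 x : vcons x c = fun i : 'I_k1.+1 => scons x env i.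
  apply: vconsP => // i; rewrite /= /env.
  by case: insubP => [j _ /val_inj->//|]; rewrite ltn_ord.
have E2 x : vcons x d =
    fun i : 'I_k2.+1 => scons x env (if i == 0%N :> nat then 0%N else i + k1)%N.
  apply: vconsP => // i; rewrite /= /env insubF ?ltnNge ?leq_addl // addnK.
  by case: insubP => [j _ /val_inj->//|]; rewrite ltn_ord.
by apply/seteqP; split=> x; rewrite /= /P E1 E2.
Qed.

(** A definable set extends to every elementary extension. *)
Lemma definable_extend (M N : structure L) (j : M -> N) (A : set M) :
  elementary j -> definable A -> exists2 B : set N, definable B & A = j @^-1` B.
Proof.
move=> ej [k [p [c ->]]]; exists [set x | sat p (vcons x (j \o c))].
  by exists k, p, (j \o c).
by apply/seteqP; split=> x /=; rewrite (vcons_comp j) (ej _ p).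
Qed.

End Definability.

Section OrderedRingDefs.
Context {E : language}.

Section Base.
Let L := oring_ext E.
Implicit Types (t u : forall M : structure L, (nat -> M) -> M).

Lemma isterm_zero : isterm (fun (M : structure L) e => Defs.zero M).
Proof.
exact: (isterm_nul (op := fun M => @finterp L M (inl OZero))
  (@isterm_app L (inl OZero))).
Qed.

Lemma isterm_one : isterm (fun (M : structure L) e => Defs.one M).
Proof.
exact: (isterm_nul (op := fun M => @finterp L M (inl OOne))
  (@isterm_app L (inl OOne))).
Qed.

Lemma isterm_opp t : isterm t -> isterm (fun M e => opp (t M e)).
Proof.
exact: (isterm_un (op := fun M => @finterp L M (inl OOpp))
  (@isterm_app L (inl OOpp))).
Qed.

Lemma isterm_add t u : isterm t -> isterm u -> isterm (fun M e => add (t M e) (u M e)).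
Proof.
exact: (isterm_bin (op := fun M => @finterp L M (inl OAdd))
  (@isterm_app L (inl OAdd))).
Qed.

Lemma isdef_lt t u : isterm t -> isterm u -> isdef (fun M e => lt (t M e) (u M e)).
Proof.
exact: (isdef_bin (Q := fun M => @rinterp L M (inl OLt))
  (@isdef_rel L (inl OLt))).
Qed.

End Base.

Section Monomials.
Let L := langM E.
Implicit Types (t u : forall M : structure L, (nat -> M) -> M).

Lemma istermM_zero : isterm (fun (M : structure L) e => Defs.zero (ring_reduct M)).
Proof.
exact: (isterm_nul (op := fun M => @finterp L M (inl (inl (inl OZero))))
  (@isterm_app L (inl (inl (inl OZero))))).
Qed.

Lemma istermM_one : isterm (fun (M : structure L) e => Defs.one (ring_reduct M)).
Proof.
exact: (isterm_nul (op := fun M => @finterp L M (inl (inl (inl OOne))))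
  (@isterm_app L (inl (inl (inl OOne))))).
Qed.

Lemma istermM_opp t : isterm t -> isterm (fun M e => opp (t M e : ring_reduct M)).
Proof.
exact: (isterm_un (op := fun M => @finterp L M (inl (inl (inl OOpp))))
  (@isterm_app L (inl (inl (inl OOpp))))).
Qed.

Lemma istermM_add t u : isterm t -> isterm u ->
  isterm (fun M e => add (t M e : ring_reduct M) (u M e)).
Proof.
exact: (isterm_bin (op := fun M => @finterp L M (inl (inl (inl OAdd))))
  (@isterm_app L (inl (inl (inl OAdd))))).
Qed.

Lemma istermM_mul t u : isterm t -> isterm u ->
  isterm (fun M e => mul (t M e : ring_reduct M) (u M e)).
Proof.
exact: (isterm_bin (op := fun M => @finterp L M (inl (inl (inl OMul))))
  (@isterm_app L (inl (inl (inl OMul))))).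
Qed.

Lemma isdefM_lt t u : isterm t -> isterm u ->
  isdef (fun M e => lt (t M e : ring_reduct M) (u M e)).
Proof.
exact: (isdef_bin (Q := fun M => @rinterp L M (inl (inl (inl OLt))))
  (@isdef_rel L (inl (inl (inl OLt))))).
Qed.

Lemma isdefM_O t : isterm t ->
  isdef (fun M e => (upred_set (M := reduct M) : set (ring_reduct M)) (t M e)).
Proof.
exact: (isdef_un (Q := fun M => @rinterp L M (inl (inr tt)))
  (@isdef_rel L (inl (inr tt)))).
Qed.

Lemma isdefM_G t : isterm t ->
  isdef (fun M e => (upred_set (M := M) : set (ring_reduct M)) (t M e)).
Proof.
exact: (isdef_un (Q := fun M => @rinterp L M (inr tt))
  (@isdef_rel L (inr tt))).
Qed.

Lemma isdefM_sat2 (p : formula (oring_ext E) 2) t u : isterm t -> isterm u ->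
  isdef (fun M e => sat (M := ring_reduct M) p (tnth [tuple t M e; u M e])).
Proof.
move=> dt du; apply: isdef_iff (isdef_sat2 (femb (femb p)) dt du) => M e.
by rewrite !sat_femb.
Qed.

End Monomials.
End OrderedRingDefs.

(** * From structures to real closed fields *)

(** [rcf_iso f g]: the structure [R] is isomorphic to the ordered field [F],
    by [f] with inverse [g]. *)
Definition rcf_iso (E : language) (R : structure (oring_ext E)) (F : rcfType)
    (f : R -> F) (g : F -> R) : Prop :=
  ([/\ cancel f g, cancel g f, f (zero R) = 0%R & f (one R) = 1%R] /\
   [/\ forall x y, f (add x y) = (f x + f y)%R,
       forall x, f (opp x) = (- f x)%R,
       forall x y, f (mul x y) = (f x * f y)%R
     & forall x y, lt x y <-> (f x < f y)%R]).

Lemma is_rcf_iso (E : language) (R : structure (oring_ext E)) :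
  is_rcf R -> exists (F : rcfType) (f : R -> F) (g : F -> R), rcf_iso f g.
Proof.
by move=> [F [f [[[g iso_fK iso_gK] iso_f0 iso_f1] [iso_fD iso_fN iso_fM flt]]]]; exists F, f, g.
Qed.

Section Transport.
Local Open Scope ring_scope.
Context {E : language} {R : structure (oring_ext E)} {F : rcfType}.
Context (f : R -> F) (g : F -> R) (iso : rcf_iso f g).

Lemma iso_fK : cancel f g. Proof. by case: iso => -[]. Qed.
Lemma iso_gK : cancel g f. Proof. by case: iso => -[]. Qed.
Lemma iso_f0 : f (zero R) = 0. Proof. by case: iso => -[]. Qed.
Lemma iso_f1 : f (one R) = 1. Proof. by case: iso => -[]. Qed.
Lemma iso_fD x y : f (add x y) = f x + f y. Proof. by case: iso => _ []. Qed.
Lemma iso_fN x : f (opp x) = - f x. Proof. by case: iso => _ []. Qed.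
Lemma iso_fM x y : f (mul x y) = f x * f y. Proof. by case: iso => _ []. Qed.
Lemma iso_lt x y : lt x y <-> f x < f y. Proof. by case: iso => _ []. Qed.

Lemma iso_inj : injective f. Proof. exact: can_inj iso_fK. Qed.

Lemma iso_nat n : f (natr R n) = n%:R.
Proof. by elim: n => [|n IH] /=; rewrite ?iso_f0 // iso_fD IH iso_f1 natr1. Qed.

Lemma iso_gD x y : g (x + y) = add (g x) (g y).
Proof. by apply: iso_inj; rewrite iso_fD !iso_gK. Qed.
Lemma iso_gB x y : g (x - y) = add (g x) (opp (g y)).
Proof. by apply: iso_inj; rewrite iso_fD iso_fN !iso_gK. Qed.
Lemma iso_gM x y : g (x * y) = mul (g x) (g y).
Proof. by apply: iso_inj; rewrite iso_fM !iso_gK. Qed.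
Lemma iso_g0 : g 0 = zero R. Proof. by rewrite -iso_f0 iso_fK. Qed.
Lemma iso_g1 : g 1 = one R. Proof. by rewrite -iso_f1 iso_fK. Qed.
Lemma iso_glt x y : lt (g x) (g y) <-> x < y.
Proof. by rewrite iso_lt !iso_gK. Qed.

Lemma iso_dist_lt d x y : dist_lt d x y <-> `|f x - f y| < f d.
Proof.
rewrite /dist_lt !iso_lt !iso_fD ltr_norml; split=> [[h1 h2]|/andP[h1 h2]].
  by apply/andP; split; lra.
by split; lra.
Qed.

Section Valuation.
Context (O : set R).
(* the set corresponding to [O] in [F] *)
Let OF : set F := [set x | O (g x)].

Lemma OF1 : subring O -> OF 1.
Proof. by move=> [h _ _]; rewrite /OF /= iso_g1; exact: h. Qed.

Lemma OFB : subring O -> forall x y, OF x -> OF y -> OF (x - y).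
Proof. by move=> [_ h _] x y; rewrite /OF /= iso_gB; exact: h. Qed.

Lemma OFM : subring O -> forall x y, OF x -> OF y -> OF (x * y).
Proof. by move=> [_ _ h] x y; rewrite /OF /= iso_gM; exact: h. Qed.

Lemma OFcv : convex O -> forall x y z, OF x -> OF z -> x < y -> y < z -> OF y.
Proof.
by move=> h x y z Ox Oz xy yz; apply: (h (g x) (g y) (g z)); rewrite ?iso_glt.
Qed.

Lemma units_ofP u : units_of O u <-> [/\ f u != 0, OF (f u) & OF (f u)^-1].
Proof.
rewrite /units_of /OF /= iso_fK; split=> [[Ou [w Ow uw]]|[u0 Ou OVu]].
  have fuw : f u * f w = 1 by rewrite -iso_fM uw iso_f1.
  have fu0 : f u != 0.
    by apply/eqP => fu0; move: fuw; rewrite fu0 mul0r => /eqP; rewrite eq_sym oner_eq0.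
  by split=> //; rewrite (_ : (f u)^-1 = f w) ?iso_fK //; apply: (mulfI fu0); rewrite fuw mulfV.
split=> //; exists (g (f u)^-1) => //.
by apply: iso_inj; rewrite iso_fM iso_gK iso_f1 mulfV.
Qed.

Lemma valuationP : subring O -> forall a b,
  valuation O a = valuation O b <-> asym OF (f a) (f b).
Proof.
move=> sO; have O1 := OF1 sO; have OM := OFM sO.
have valP a b : valuation O b a <-> asym OF (f a) (f b).
  split=> [[u /units_ofP[u0 Ou OVu] <-]|[u [u0 Ou OVu ab]]].
    by exists (f u); rewrite iso_fM mulrC.
  exists (g u); first by apply/units_ofP; rewrite iso_gK.
  by apply: iso_inj; rewrite iso_fM iso_gK ab mulrC.
move=> a b; split=> [ab|ab].
  by apply/valP; rewrite -ab; apply/valP; exact: asym_refl.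
apply/seteqP; split=> x /valP h; apply/valP; apply: asym_trans h _ => //.
exact: asym_sym.
Qed.

End Valuation.

Section Exp.
Context (e : R -> R) (ee : exponential e).
(* the function corresponding to [e] on [F] *)
Let eF x := f (e (g x)).

Lemma eFD x y : eF (x + y) = eF x * eF y.
Proof. by case: ee => _ h _ _; rewrite /eF iso_gD h iso_fM. Qed.

Lemma eF_gt0 x : 0 < eF x.
Proof.
case: ee => -[h _ _] _ _ _; rewrite -iso_f0 /eF -iso_lt.
by apply: h.
Qed.

Lemma eF_mono : {mono eF : x y / x < y}.
Proof.
case: ee => _ _ h _ x y; apply/idP/idP; first by rewrite /eF -iso_lt -h iso_glt.
by rewrite -iso_glt h iso_lt.
Qed.

Lemma eF_log : exists l : F -> F, forall y, 0 < y -> eF (l y) = y.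
Proof.
suff /choice[l hl] : forall y, exists x, 0 < y -> eF x = y by exists l.
move=> y; have [y0|ny] := pselect (0 < y); last by exists 0 => /ny.
case: ee => -[_ _ h] _ _ _; have [|x _ xy] := h (g y).
  by apply/iso_lt; rewrite iso_f0 iso_gK.
by exists (f x) => _; rewrite /eF iso_fK xy iso_gK.
Qed.

(** An increasing bijection onto the positive elements is continuous. *)
Lemma exp_continuous : continuous_fun e.
Proof.
have [l lK] := eF_log.
move=> x e0 /iso_lt; rewrite iso_f0 => e_gt0.
set y := f (e x); have yE : y = eF (f x) by rewrite /eF iso_fK.
have y0 : 0 < y by rewrite yE; exact: eF_gt0.
have [d [d0 dy de]] : exists d, [/\ 0 < d, d < y & d < f e0].
  exists (Num.min y (f e0) / 2%:R); have hm : 0 < Num.min y (f e0) by rewrite lt_min y0.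
  have [h1 h2] : Num.min y (f e0) <= y /\ Num.min y (f e0) <= f e0.
    by rewrite !ge_min !lexx orbT.
  by split; lra.
have l1 := lK (y - d); have l2 := lK (y + d).
have lt1 : l (y - d) < f x by rewrite -eF_mono -yE l1; lra.
have lt2 : f x < l (y + d) by rewrite -eF_mono -yE l2; lra.
set r := Num.min (f x - l (y - d)) (l (y + d) - f x).
have r0 : 0 < r by rewrite lt_min !subr_gt0 lt1.
exists (g r); first by apply/iso_lt; rewrite iso_f0 iso_gK.
move=> z /iso_dist_lt; rewrite iso_gK ltr_norml lt_min /r => /andP[].
rewrite ltrNl lt_min => /andP[h1 h2] /andP[h3 h4].
apply/iso_dist_lt; rewrite -/y.
have z1 : y - d < f (e z).
  by rewrite -(iso_fK z) -/(eF (f z)) -l1 ?eF_mono; lra.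
have z2 : f (e z) < y + d.
  by rewrite -(iso_fK z) -/(eF (f z)) -l2 ?eF_mono; lra.
by rewrite ltr_norml; lra.
Qed.

(** Near 0 the inequality follows from the derivative at 0, and it extends to
    [2 x] by squaring; in an archimedean field every element is reached. *)
Lemma eF_growth : archimedean R -> forall x, 0 < x -> 1 + x / 2%:R <= eF x.
Proof.
move=> ar; case: ee => _ _ _ /(_ (zero R) (g 2%:R^-1)).
have e0 : eF 0 = 1.
  have h := eF_gt0 0; apply: (mulfI (lt0r_neq0 h)); rewrite -eFD addr0 mulr1 //.
have -> : e (zero R) = one R by apply: iso_inj; rewrite -iso_g0 -/(eF 0) e0 iso_f1.
move=> []; first by apply/iso_lt; rewrite iso_f0 iso_gK invr_gt0 ltr0n.
move=> d /iso_lt; rewrite iso_f0 => d0 hd.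
have small x : 0 < x -> x < f d -> 1 + x / 2%:R <= eF x.
  move=> x0 xd; have := hd (g x) (g ((eF x - 1) / x)).
  have nz : g x <> zero R by rewrite -iso_g0 => /(can_inj iso_gK) xE; move: x0; rewrite xE ltxx.
  have h1 : dist_lt d (g x) (zero R).
    by apply/iso_dist_lt; rewrite iso_gK iso_f0 subr0 gtr0_norm.
  move=> /(_ nz h1)[].
    apply: iso_inj; rewrite iso_fM iso_fD iso_fN !iso_gK -/(eF 0) iso_f1.
    have -> : add (zero R) (g x) = g x by apply: iso_inj; rewrite iso_fD iso_f0 add0r.
    by rewrite mulfVK ?gt_eqF.
  move=> _ /iso_lt; rewrite iso_fD !iso_gK iso_f1 => h.
  have : 1 / 2%:R <= (eF x - 1) / x by lra.
  by rewrite ler_pdivlMr // => h2; lra.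
have dbl n x : 0 < x -> x < 2%:R ^+ n * f d -> 1 + x / 2%:R <= eF x.
  elim: n x => [|n IH] x x0; first by rewrite expr0 mul1r; exact: small.
  rewrite exprS => xd.
  have := IH (x / 2%:R); set t := eF (x / 2%:R) => ht.
  have tE : eF x = t * t by rewrite /t -eFD -splitr.
  have tx : 1 + x / 2%:R / 2%:R <= t by apply: ht; lra.
  rewrite tE.
  have : (1 + x / 2%:R / 2%:R) * (1 + x / 2%:R / 2%:R) <= t * t.
    by apply: ler_pM => //; lra.
  have : 0 <= (x / 2%:R / 2%:R) * (x / 2%:R / 2%:R) by apply: mulr_ge0; lra.
  by lra.
move=> x x0; have [n /iso_lt] := ar (g (x / f d)).
rewrite iso_gK iso_nat ltr_pdivrMr // => xn.
apply: (dbl n) => //; apply: lt_le_trans xn _.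
by rewrite ler_pM2r // -natrX ler_nat ltnW // ltn_expl.
Qed.

End Exp.
End Transport.

(** * A definable set separating the natural numbers *)

(** The set [nat_cut], expressed by means of the formula [expf]; the parameter
    [m] is a monomial and [x] stands for [exp m - 1]. As [expf] defines a
    function, the universal quantifiers over its values could be existential
    ones. *)
Definition cut_set (E : language) (expf : formula (oring_ext E) 2)
    (S : structure (langM E)) (m x : ring_reduct S) : set S :=
  let R := ring_reduct S in
  let G := upred_set (M := S) : set R in
  let exp_eq (x y : R) := sat (M := R) expf (tnth [tuple x; y]) in
  [set a : R | a = zero R \/
    [/\ lt (zero R) a, forall y, exp_eq (mul a m) y -> G y
      & forall y z w, exp_eq (mul a m) y -> mul z x = add y (opp (one R)) ->
          exp_eq (add z (opp (one R))) w -> G w]].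

Lemma definable_cut_set (E : language) (expf : formula (oring_ext E) 2)
  (S : structure (langM E)) (m x : ring_reduct S) : definable (cut_set expf m x).
Proof.
pose P (S : structure (langM E)) (e : nat -> S) :=
  let R := ring_reduct S in
  let G := upred_set (M := S) : set R in
  (e 0%N = zero R :> R) \/
    (lt (zero R) (e 0%N) /\
    ((forall y : S, sat (M := R) expf (tnth [tuple mul (e 0%N : R) (e 1%N); y]) -> G y) /\
     (forall y z w : S, sat (M := R) expf (tnth [tuple mul (e 0%N : R) (e 1%N); y]) ->
        mul (z : R) (e 2%N) = add (y : R) (opp (one R)) ->
        sat (M := R) expf (tnth [tuple add (z : R) (opp (one R)); w]) -> G w))).
have dP : isdef P.
  rewrite /P; apply: isdef_or; first by apply: isdef_eq; [exact: isterm_var|exact: istermM_zero].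
  apply: isdef_and.
    by apply: isdefM_lt; [exact: istermM_zero|exact: isterm_var].
  apply: isdef_and.
    apply: isdef_all; apply: isdef_imp; last exact/isdefM_G/isterm_var.
    apply: isdefM_sat2; last exact: isterm_var.
    by apply: istermM_mul; exact: isterm_var.
  do 3 (apply: isdef_all).
  apply: isdef_imp.
    apply: isdefM_sat2; last exact: isterm_var.
    by apply: istermM_mul; exact: isterm_var.
  apply: isdef_imp.
    apply: isdef_eq; first by apply: istermM_mul; exact: isterm_var.
    by apply: istermM_add; [exact: isterm_var|apply: istermM_opp; exact: istermM_one].
  apply: isdef_imp; last exact/isdefM_G/isterm_var.
  apply: isdefM_sat2; last exact: isterm_var.
  by apply: istermM_add; [exact: isterm_var|apply: istermM_opp; exact: istermM_one].
have := @definable_isdef (langM E) P S (scons m (fun=> x)) dP; congr definable.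
apply/seteqP; split=> a /=; rewrite /P /cut_set /=.
  by case=> [|[h1 [h2 h3]]]; [left|right].
by case=> [|[h1 h2 h3]]; [left|right].
Qed.

Section Models.
Context {E : language} (T : theory (oring_ext E)) (expf : formula (oring_ext E) 2).
Context (Trcf : extends_rcf T) (Texp : defines_exponential T expf).

Lemma cut_set_spec (S : structure (langM E)) : TM_model T expf S ->
  exists m x : ring_reduct S,
    [/\ forall n, cut_set expf m x (natr (ring_reduct S) n)
      & forall a : ring_reduct S, cut_set expf m x a -> ~ naturals (ring_reduct S) a ->
          forall n, lt (natr (ring_reduct S) n) a].
Proof.
move=> [[TR TO [a0 nOa]] [[Gn0 G1 GM GV] [_ Ginj Gsurj]] GT].
have [F [f [g iso]]] := is_rcf_iso (Trcf TR).
have [e ee ef] := Texp TR.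
set R := ring_reduct S in G1 GM GV GT F f g iso e ee ef *.
set O := upred_set (M := reduct S) : set R in TO nOa Ginj Gsurj.
set G := upred_set (M := S) : set R in Gn0 G1 GM GV Ginj Gsurj GT.
have [sO cO OT] := TO.
have [l lK] := eF_log iso ee.
pose OF : set F := [set x | O (g x)].
pose GF : set F := [set x | G (g x)].
pose eF x := f (e (g x)).
have O1 : OF 1%R := OF1 iso sO.
have OB := OFB iso sO; have OM := OFM iso sO; have Ocv := OFcv iso cO.
have Oe x : OF x -> OF (eF x).
  rewrite /OF /eF /= (iso_fK iso) => Ox; apply: OT => //; first by exists expf.
  exact: (exp_continuous iso ee).
have gK := iso_gK iso.
have GF1 : GF 1%R by rewrite /GF /= (iso_g1 iso).
have GFM x y : GF x -> GF y -> GF (x * y)%R.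
  by rewrite /GF /= (iso_gM iso); exact: GM.
have GFV x y : GF x -> (x * y = 1)%R -> GF y.
  move=> Gx xy; apply: GV Gx _; rewrite -(iso_gM iso) xy; exact: (iso_g1 iso).
have GFinj x : GF x -> asym OF x 1%R -> x = 1%R.
  move=> Gx x1; apply: (can_inj gK); apply: (Ginj _ _ _ _ _).
  - by rewrite in_setE.
  - by rewrite in_setE.
  - by apply/(valuationP iso sO); rewrite !gK.
have GFe x : GF x -> (1 < x)%R -> GF (eF x).
  move=> Gx x1; rewrite /GF /eF /= (iso_fK iso).
  have [] // := GT (g x) (e (g x)) Gx _ _; last exact/ef.
  by rewrite -/(one R) -(iso_g1 iso); apply/(iso_glt iso).
(* a monomial greater than 1: the square of a monomial not in [O] *)
have [u Gu uO] : exists2 u, GF u & ~ OF u.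
  have a00 : a0 <> zero R.
    by move=> a0E; apply: nOa; rewrite a0E -(iso_g0 iso); exact: (convex_0 O1 OB).
  have [|v Gv va] := Gsurj (valuation O a0); first by exists a0.
  exists (f v); first by rewrite /GF /= (iso_fK iso).
  move=> Ov; apply: nOa; move/(valuationP iso sO): va => /asym_O h.
  by have := h OM Ov; rewrite /= (iso_fK iso).
have [m [Gm m1]] : exists m, GF m /\ (1 < m)%R.
  exists (u * u)%R; split; first exact: GFM.
  have : (1 < `|u|)%R.
    rewrite ltNge; apply/negP => h; apply: uO; apply: (convex_le O1 OB Ocv O1).
    by rewrite normr1.
  by move=> h; rewrite -[(u * u)%R]expr2 -real_normK ?num_real // exprn_egt1.
have eFD' x y : (eF (x + y) = eF x * eF y)%R := eFD iso ee x y.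
have eF_gt0' x : (0 < eF x)%R := eF_gt0 iso ee x.
have eF_mono' : {mono eF : x y / (x < y)%R} := eF_mono iso ee.
have cutP (a : R) : cut_set expf (g m) (g (eF m - 1)%R) a <-> nat_cut eF GF m (f a).
  have a0P : (a = zero R) <-> (f a = 0%R).
    by rewrite -(iso_f0 iso); split=> [->//|/(iso_inj iso)].
  have em0 : (0 < eF m - 1)%R := cut_em_gt1 eFD' eF_gt0' eF_mono' m1.
  have expE y : (sat (M := R) expf (tnth [tuple mul a (g m); y])) <-> y = g (eF (f a * m)%R).
    rewrite ef; suff -> : e (mul a (g m)) = g (eF (f a * m)%R) by [].
    by rewrite /eF (iso_fK iso); congr e; apply: (iso_inj iso); rewrite (iso_fM iso) !gK.
  have expE2 z w : (sat (M := R) expf (tnth [tuple add z (opp (one R)); w])) <->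
      w = g (eF (f z - 1)%R).
    rewrite ef; suff -> : e (add z (opp (one R))) = g (eF (f z - 1)%R) by [].
    by rewrite /eF (iso_fK iso); congr e; apply: (iso_inj iso);
      rewrite (iso_fD iso) (iso_fN iso) (iso_f1 iso) !gK.
  rewrite /cut_set /nat_cut /=; split=> [[/a0P|[h1 h2 h3]]|[/a0P|[h1 h2 h3]]]; first by left.
  - right; split; first by move/(iso_lt iso): h1; rewrite (iso_f0 iso).
      by apply: h2; apply/expE.
    apply: (h3 (g (eF (f a * m)%R)) (g (geom_sum eF m (f a)))); first exact/expE.
      apply: (iso_inj iso); rewrite (iso_fM iso) (iso_fD iso) (iso_fN iso) (iso_f1 iso) !gK.
      by rewrite /geom_sum mulfVK // gt_eqF.
    by apply/expE2; rewrite gK.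
  - by left.
  - right; split; first by apply/(iso_lt iso); rewrite (iso_f0 iso).
      by move=> y /expE->.
    move=> y z w /expE -> zE /expE2 ->.
    suff -> : f z = geom_sum eF m (f a) by [].
    have := congr1 f zE; rewrite (iso_fM iso) (iso_fD iso) (iso_fN iso) (iso_f1 iso) !gK => zE'.
    by apply: (mulIf (lt0r_neq0 em0)); rewrite zE' /geom_sum mulfVK // gt_eqF.
exists (g m), (g (eF m - 1)%R); split=> [n|a /cutP ca na n].
  apply/cutP; rewrite (iso_nat iso).
  exact: (nat_cut_nat eFD' eF_gt0' eF_mono' GF1 GFM Gm m1 GFe).
apply/(iso_lt iso); rewrite (iso_nat iso).
have h := nat_cut_gt O1 OB Ocv eFD' eF_gt0' eF_mono' Oe GFM GFV GFinj Gm m1 GFe ca.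
by apply: h => k ak; apply: na; exists k => //; apply: (iso_inj iso); rewrite (iso_nat iso) ak.

Qed.

Lemma definable_cut (S : structure (langM E)) : TM_model T expf S ->
  exists A : set S,
    [/\ definable A, naturals (ring_reduct S) `<=` A
      & forall a : ring_reduct S, A a -> ~ naturals (ring_reduct S) a ->
          forall n, lt (natr (ring_reduct S) n) a].
Proof.
move=> /cut_set_spec[m [x [h1 h2]]]; exists (cut_set expf m x); split=> //.
  exact: definable_cut_set.
by move=> _ [n _ <-].
Qed.

End Models.

(** * External definability *)

Lemma exists_ultrafilter_nat : exists U : set_system nat,
  UltraFilter U /\ forall n, U [set i | (n <= i)%N].
Proof.
have [U [UU sU]] := ultraFilterLemma eventually_filter.
by exists U; split=> // n; apply: sU; exists n.
Qed.

Lemma urepr_tuple2 (L : language) (T : Type) (U : set_system T) (M : structure L)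
    (x y : upower U M) (Q : ('I_2 -> M) -> Prop) :
  U [set i | Q (fun k => urepr (tnth [tuple x; y] k) i)] <->
  U [set i | Q (tnth [tuple urepr x i; urepr y i])].
Proof.
suff -> : (fun i => Q (fun k => urepr (tnth [tuple x; y] k) i)) =
  (fun i => Q (tnth [tuple urepr x i; urepr y i])) by [].
apply/funext => i; rewrite !tnth2; congr Q.
by apply/funext => k; case: ifP.
Qed.

Lemma lt_upower (E : language) (T : Type) (U : set_system T)
    (M : structure (oring_ext E)) (x y : upower U M) :
  lt x y <-> U [set i | lt (urepr x i) (urepr y i)].
Proof. exact: (urepr_tuple2 _ _ (@rinterp (oring_ext E) M (inl OLt))). Qed.

Section ExternalDefinability.
Context {E : language} (T : theory (oring_ext E)) (expf : formula (oring_ext E) 2).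
Context (Trcf : extends_rcf T) (Texp : defines_exponential T expf).

(** In the ultrapower, the class [c] of the sequence of the natural numbers
    lies above every natural number and below all the elements of [S] which
    have that property. *)
Lemma externally_definable_nat (S : structure (langM E)) : TM_model T expf S ->
  externally_definable (M := S) (naturals (ring_reduct S)).
Proof.
move=> SM; have [A [dA NA Agt]] := definable_cut Trcf Texp SM.
have [[TR _ _] _ _] := SM.
have [F [f [g iso]]] := is_rcf_iso (Trcf TR).
set R := ring_reduct S in NA Agt F f g iso *.
have [U [UU Uge]] := exists_ultrafilter_nat.
pose N := upower U S.
have ej := elementary_udiag UU (zero R : S).
have [B dB AB] := definable_extend ej dA.
pose c : N := upi U (fun n => natr R n : S).
have ltE (x y : ring_reduct N) :
    lt x y <-> U [set i | lt (urepr (x : N) i : R) (urepr (y : N) i)].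
  exact: (urepr_tuple2 _ _ (@rinterp (langM E) S (inl (inl (inl OLt))))).
have ltc (a : S) : lt (udiag U a : ring_reduct N) c <-> U [set i | lt (a : R) (natr R i)].
  have ae : U [set i | urepr (upi U (fun=> a)) i = a /\
      urepr (upi U (fun n => natr R n : S)) i = natr R i].
    exact: (filterI (urepr_upi UU (fun=> a)) (urepr_upi UU (fun n => natr R n : S))).
  rewrite ltE; split=> h.
    by apply: filterS (filterI h ae) => i /= [+ [E1 E2]]; rewrite /udiag /c E1 E2.
  by apply: filterS (filterI h ae) => i /= [+ [E1 E2]]; rewrite /udiag /c E1 E2.
exists N, (@udiag _ _ U S), (B `&` [set x | lt (x : ring_reduct N) c]).
split=> //.
  apply: definable_setI dB _.
  pose P (M : structure (langM E)) (e : nat -> M) := lt (e 0%N : ring_reduct M) (e 1%N).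
  have dP : isdef P by apply: isdefM_lt; exact: isterm_var.
  exact: (definable_isdef (fun=> c) dP).
apply/seteqP; split=> a /=.
  move=> na; split; first by have := NA _ na; rewrite AB.
  apply/ltc; have [n _ <-] := na; apply: filterS (Uge n.+1) => i /= ni.
  by apply/(iso_lt iso); rewrite !(iso_nat iso) ltr_nat.
move=> [Ba /ltc Ua]; apply: contrapT => na.
have Aa : A a by rewrite AB.
have [i /= /(iso_lt iso) h] := filter_ex Ua.
by have /(iso_lt iso) := Agt a Aa na i; rewrite ltNge ltW.
Qed.

End ExternalDefinability.

(** * Suprema of definable sets and boundedness of continuous functions *)

Section DefinableCompleteness.
Local Open Scope ring_scope.

(** [is_sup X s]: [s] is the least upper bound of [X]. *)
Definition is_sup (F : rcfType) (X : set F) (s : F) : Prop :=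
  (forall x, X x -> x <= s) /\ (forall r, r < s -> exists2 x, X x & r < x).

Lemma is_sup_bigcup (F : rcfType) n (X : 'I_n -> set F) :
  (forall i, X i !=set0 -> exists s, is_sup (X i) s) ->
  (\bigcup_i X i) !=set0 -> exists s, is_sup (\bigcup_i X i) s.
Proof.
move=> hX [x0 [i0 _ Xx0]].
have /choice[s hs] : forall i, exists s, X i !=set0 -> is_sup (X i) s.
  move=> i; have [/hX[s ?]|ne] := pselect (X i !=set0); first by exists s.
  by exists 0 => /ne.
pose P : pred 'I_n := fun i => `[< X i !=set0 >].
have P0 : P i0 by apply/asboolP; exists x0.
case: (Order.TotalTheory.arg_maxP s P0) => i /asboolP Xi smax.
exists (s i); split=> [x [j _ Xjx]|r /(hs i Xi).2[x Xx rx]]; last first.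
  by exists x => //; exists i.
have Xj : X j !=set0 by exists x.
by apply: le_trans ((hs j Xj).1 _ Xjx) _; apply: smax; exact/asboolP.
Qed.

Context {E : language} {R : structure (oring_ext E)} {F : rcfType}.
Context (f : R -> F) (g : F -> R) (iso : rcf_iso f g).

(** A finite union of points and intervals has a least upper bound as soon as
    it is nonempty and bounded above. *)
Lemma definable_sup (A : set R) : o_minimal_structure R -> definable A ->
  A !=set0 -> (exists b, forall x, A x -> f x <= b) ->
  exists s, is_sup (f @` A) s.
Proof.
move=> om dA [a0 Aa0] [b Ab]; have [n [c Ac]] := om A dA.
have fA : f @` A = \bigcup_i (f @` piece_set (c i)).
  by rewrite Ac image_bigcup.
rewrite fA; apply: is_sup_bigcup; last by rewrite -fA; exists (f a0), a0.
move=> i [_ [x xc _]].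
have bd y : piece_set (c i) y -> f y <= b.
  by move=> cy; apply: Ab; rewrite Ac; exists i.
case: (c i) xc bd => [p|lo hi] /=.
  move=> _ bd; exists (f p); split=> [_ [_ -> <-]//|r rp].
  by exists (f p) => //; exists p.
move=> [lox hix] bd; case: hi => [h|] in hix bd *; last first.
  (* an interval without upper end point is not bounded above *)
  have : f (g (Num.max b (f x) + 1)) <= b.
    apply: bd; split=> //; case: lo lox => // lo /(iso_lt iso) h.
    apply/(iso_lt iso); rewrite (iso_gK iso).
    have : f x <= Num.max b (f x) by rewrite le_max lexx orbT.
    by lra.
  rewrite (iso_gK iso) => h; have : b <= Num.max b (f x) by rewrite le_max lexx.
  by lra.
have /(iso_lt iso) hx := hix.
exists (f h); split=> [_ [y [_ /(iso_lt iso) yh] <-]|r rh]; first exact: ltW.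
have [m1 m2] : f x <= Num.max (f x) r /\ r <= Num.max (f x) r.
  by rewrite !le_max !lexx orbT.
have m3 : Num.max (f x) r < f h by rewrite gt_max hx.
set m := Num.max _ _ in m1 m2 m3.
exists ((m + f h) / 2%:R); last by lra.
exists (g ((m + f h) / 2%:R)); last exact: iso_gK iso _.
split; last by apply/(iso_lt iso); rewrite (iso_gK iso); lra.
clear bd; case: lo lox => // lo /(iso_lt iso) h1; apply/(iso_lt iso); rewrite (iso_gK iso).
by lra.
Qed.

(** The function defined by [p] is bounded by [b] in absolute value on the open
    interval from [- a] to [x]. *)
Definition bounded_on (p : formula (oring_ext E) 2) (M : structure (oring_ext E))
    (a x b : M) : Prop :=
  forall t y : M, lt (opp a) t -> lt t x -> sat p (tnth [tuple t; y]) ->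
    lt (opp b) y /\ lt y b.

Lemma isdef_bounded_on (p : formula (oring_ext E) 2)
    (a x b : forall M : structure (oring_ext E), (nat -> M) -> M) :
  isterm (fun M e => a M (fun k => e k.+2)) ->
  isterm (fun M e => x M (fun k => e k.+2)) ->
  isterm (fun M e => b M (fun k => e k.+2)) ->
  isdef (fun M e => bounded_on p (a M e) (x M e) (b M e)).
Proof.
move=> da dx db; rewrite /bounded_on; do 2 (apply: isdef_all).
apply: isdef_imp; first by apply: isdef_lt; [exact: isterm_opp|exact: isterm_var].
apply: isdef_imp; first by apply: isdef_lt; [exact: isterm_var|].
apply: isdef_imp; first by apply: isdef_sat2; exact: isterm_var.
apply: isdef_and; apply: isdef_lt => //; first exact: isterm_opp.
- exact: isterm_var.
- exact: isterm_var.
Qed.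

(** A definable continuous function is bounded on bounded intervals: consider
    the supremum of the [x <= a] such that it is bounded from [- a] to [x]. *)
Lemma continuous_bounded (p : formula (oring_ext E) 2) (h : R -> R) (a : R) :
  o_minimal_structure R -> defines_fun p h -> continuous_fun h ->
  lt (zero R) a -> exists b, bounded_on p a a b.
Proof.
move=> om ph hc /(iso_lt iso); rewrite (iso_f0 iso) => a0.
have bndE x b : bounded_on p a x b <->
    forall t, - f a < f t -> f t < f x -> `|f (h t)| < f b.
  split=> [H t t1 t2|H t y /(iso_lt iso) + /(iso_lt iso) t2 /ph ->].
    have [] := H t (h t) _ _ _; rewrite ?(iso_lt iso) ?(iso_fN iso) //; first exact/ph.
    by move=> h1 h2; rewrite ltr_norml h1.
  rewrite (iso_fN iso) => t1; have := H t t1 t2; rewrite ltr_norml => /andP[h1 h2].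
  by rewrite !(iso_lt iso) (iso_fN iso).
pose B : set R := [set x | (exists b, bounded_on p a x b) /\ ~ lt a x].
have dB : definable B.
  pose P (M : structure (oring_ext E)) (e : nat -> M) :=
    (exists b : M, bounded_on p (e 1%N) (e 0%N) b) /\ ~ lt (e 1%N) (e 0%N).
  have dP : isdef P.
    apply: isdef_and.
      apply: isdef_ex; apply: isdef_bounded_on; exact: isterm_var.
    by apply: isdef_not; apply: isdef_lt; exact: isterm_var.
  exact: (definable_isdef (fun=> a) dP).
have BE x : B x <-> (exists b, bounded_on p a x b) /\ f x <= f a.
  by rewrite /B /= (iso_lt iso) leNgt; split=> -[? h1]; split=> //; apply/negP.
have Bna : B (opp a).
  apply/BE; rewrite (iso_fN iso); split; last by lra.
  by exists a; apply/bndE => t; rewrite (iso_fN iso) => t1 t2; lra.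
have [||s [s1 s2]] := definable_sup om dB.
- by exists (opp a).
- by exists (f a) => x /BE[].
have lt01 : lt (zero R) (one R) by apply/(iso_lt iso); rewrite (iso_f0 iso) (iso_f1 iso).
have [d d0 hd] := hc (g s) _ lt01.
move/(iso_lt iso): d0; rewrite (iso_f0 iso) => d0.
have [|_ [x /BE[[b /bndE hb] xa] <-] xs] := s2 (s - f d); first by lra.
have xs' : f x <= s by apply: s1; exists x => //; apply/BE; split=> //; exists b; exact/bndE.
pose b' := g (`|f b| + `|f (h (g s))| + 1).
(* by continuity at [s], boundedness extends beyond [s] *)
have key x' : f x' <= s + f d -> bounded_on p a x' b'.
  move=> x's; apply/bndE => t t1 t2; rewrite /b' (iso_gK iso).
  have nb := normr_ge0 (f b); have nh := normr_ge0 (f (h (g s))).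
  have [tx|tx] := ltP (f t) (f x).
    by have := hb t t1 tx; have := ler_norm (f b); lra.
  have /hd/(iso_dist_lt iso) : dist_lt d (g s) t.
    by apply/(iso_dist_lt iso); rewrite (iso_gK iso) ltr_norml; lra.
  rewrite (iso_f1 iso) => h1.
  have := ler_normB (f (h (g s))) (f (h (g s)) - f (h t)).
  rewrite opprB addrCA subrr addr0 => h2; lra.
have [sa|sa] := ltP s (f a); last by exists b'; apply: key; lra.
pose x' := g (Num.min (s + f d) (f a)).
have x'1 : f x' <= s + f d by rewrite (iso_gK iso) ge_min lexx.
have x's : s < f x' by rewrite (iso_gK iso) lt_min sa andbT; lra.
have : f x' <= s.
  apply: s1; exists x' => //; apply/BE; split; first by exists b'; exact: key.
  by rewrite (iso_gK iso) ge_min lexx orbT.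
by rewrite leNgt x's.
Qed.

End DefinableCompleteness.

(** * A model whose valuation ring consists of the finite elements *)

(** The convex hull of the integers. *)
Definition finite_part (E : language) (R : structure (oring_ext E)) : set R :=
  [set x | exists n, lt (opp (natr R n)) x /\ lt x (natr R n)].

Arguments finite_part {E} R _.

Section Transfer.
Local Open Scope ring_scope.
Context {E : language} {M N : structure (oring_ext E)} (j : M -> N).
Context (ej : elementary j).

Lemma elementary_natr n : j (natr M n) = natr N n.
Proof.
elim: n => [|n IH] /=.
  pose P (K : structure (oring_ext E)) (e : nat -> K) := e 0%N = zero K.
  have dP : isdef P by apply: isdef_eq; [exact: isterm_var|exact: isterm_zero].
  exact: ((elementary_isdef (fun=> zero M) ej dP).1 erefl).
pose P (K : structure (oring_ext E)) (e : nat -> K) := e 0%N = add (e 1%N) (one K).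
have dP : isdef P.
  apply: isdef_eq; first exact: isterm_var.
  by apply: isterm_add; [exact: isterm_var|exact: isterm_one].
have /= := (elementary_isdef (scons (add (natr M n) (one M)) (fun=> natr M n)) ej dP).1 erefl.
by rewrite /P /= IH.
Qed.

Context (Mrcf : is_rcf M) (Nrcf : is_rcf N).

Lemma elementary_defines_fun (p : formula (oring_ext E) 2) (h : N -> N) :
  defines_fun p h -> exists h0 : M -> M, defines_fun p h0.
Proof.
move=> ph.
pose P (K : structure (oring_ext E)) (e : nat -> K) := forall x : K, exists y : K,
  sat p (tnth [tuple x; y]) /\ forall z : K, sat p (tnth [tuple x; z]) -> z = y.
have dP : isdef P.
  apply: isdef_all; apply: isdef_ex; apply: isdef_and.
    by apply: isdef_sat2; exact: isterm_var.
  apply: isdef_all; apply: isdef_imp; first by apply: isdef_sat2; exact: isterm_var.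
  by apply: isdef_eq; exact: isterm_var.
have PN e : P N e by move=> x; exists (h x); split=> [|z]; rewrite ph.
have := (elementary_isdef (fun=> zero M) ej dP).2 (PN _).
move=> /choice[h0 h0P]; exists h0 => x y.
by have [h1 h2] := h0P x; split=> [/h2//|->].
Qed.

Lemma elementary_continuous (p : formula (oring_ext E) 2) (h : N -> N) (h0 : M -> M) :
  defines_fun p h -> defines_fun p h0 -> continuous_fun h -> continuous_fun h0.
Proof.
move=> ph ph0 hc.
pose P (K : structure (oring_ext E)) (e : nat -> K) := forall x y r : K,
  sat p (tnth [tuple x; y]) -> lt (zero K) r -> exists d : K, lt (zero K) d /\
  forall x' y' : K, dist_lt d x x' -> sat p (tnth [tuple x'; y']) -> dist_lt r y y'.
have ddist (a b c : forall K : structure (oring_ext E), (nat -> K) -> K) :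
    isterm a -> isterm b -> isterm c -> isdef (fun K e => dist_lt (a K e) (b K e) (c K e)).
  by move=> da db dc; apply: isdef_and; apply: isdef_lt => //; exact: isterm_add.
have dP : isdef P.
  do 3 (apply: isdef_all).
  apply: isdef_imp; first by apply: isdef_sat2; exact: isterm_var.
  apply: isdef_imp; first by apply: isdef_lt; [exact: isterm_zero|exact: isterm_var].
  apply: isdef_ex; apply: isdef_and.
    by apply: isdef_lt; [exact: isterm_zero|exact: isterm_var].
  do 2 (apply: isdef_all).
  apply: isdef_imp; first by apply: ddist; exact: isterm_var.
  apply: isdef_imp; first by apply: isdef_sat2; exact: isterm_var.
  by apply: ddist; exact: isterm_var.
have PN e : P N e.
  move=> x y r /ph-> r0; have [d d0 hd] := hc x r r0.
  by exists d; split=> // x' y' xx' /ph->; exact: hd.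
have PM := (elementary_isdef (fun=> zero M) ej dP).2 (PN _).
move=> x r r0; have [|d [d0 hd]] := PM x (h0 x) r _ r0; first exact/ph0.
by exists d => // y xy; apply: hd xy _; exact/ph0.
Qed.

(** A bound for a continuous function on a bounded interval of [M] is also a
    bound in [N]. *)
Lemma T_convex_finite : o_minimal_structure M -> archimedean M ->
  T_convex_subring (finite_part N).
Proof.
move=> om ar.
have [F [f [g iso]]] := is_rcf_iso Nrcf.
have [F0 [f0 [iso_g0 iso0]]] := is_rcf_iso Mrcf.
have finP x : finite_part N x <-> exists n, `|f x| < n%:R.
  rewrite /finite_part /=; split=> -[n].
    rewrite !(iso_lt iso) (iso_fN iso) (iso_nat iso) => -[h1 h2].
    by exists n; rewrite ltr_norml h1.
  by rewrite ltr_norml => /andP[h1 h2]; exists n; rewrite !(iso_lt iso) (iso_fN iso) (iso_nat iso).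
split.
- split; first by apply/finP; exists 2%N; rewrite (iso_f1 iso) normr1; lra.
    move=> x y /finP[n xn] /finP[m ym]; apply/finP; exists (n + m)%N.
    rewrite (iso_fD iso) (iso_fN iso) natrD; apply: le_lt_trans (ler_normB _ _) _.
    exact: ltrD.
  move=> x y /finP[n xn] /finP[m ym]; apply/finP; exists (n * m)%N.
  by rewrite (iso_fM iso) normrM natrM; apply: ltr_pM.
- move=> x y z /finP[n xn] /finP[m zm] /(iso_lt iso) xy /(iso_lt iso) yz.
  apply/finP; exists (n + m)%N; move: xn zm; rewrite !ltr_norml natrD.
  have h1 : 0 <= n%:R :> F := ler0n _ _.
  have h2 : 0 <= m%:R :> F := ler0n _ _.
  by move=> /andP[? ?] /andP[? ?]; apply/andP; split; lra.
move=> h [p ph] hc x [n [nx xn]].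
have [h0 ph0] := elementary_defines_fun ph.
have h0c := elementary_continuous ph ph0 hc.
(* [bounded_on] is about open intervals, hence [n.+1] *)
pose a := natr M n.+1.
have a0 : lt (zero M) a by apply/(iso_lt iso0); rewrite (iso_f0 iso0) (iso_nat iso0) ltr0n.
have [b hb] := continuous_bounded iso0 om ph0 h0c a0.
have [k bk] := ar b.
pose P (K : structure (oring_ext E)) (e : nat -> K) := bounded_on p (e 0%N) (e 0%N) (e 1%N).
have dP : isdef P by apply: isdef_bounded_on; exact: isterm_var.
have PM : P M (scons a (fun=> natr M k)).
  move=> t y t1 t2 ty; have [] := hb t y t1 t2 ty.
  rewrite /= !(iso_lt iso0) !(iso_fN iso0); move/(iso_lt iso0): bk => bk h1 h2.
  by split; lra.
have := (elementary_isdef _ ej dP).1 PM; rewrite /P /= !elementary_natr.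
move=> /(_ x (h x)) hx; exists k; apply: hx; last exact/ph.
  move: nx; rewrite !(iso_lt iso) !(iso_fN iso) !(iso_nat iso) -natr1; lra.
move: xn; rewrite !(iso_lt iso) !(iso_nat iso) -natr1; lra.
Qed.

(** The inequality [1 + x/2 <= exp x] transfers from an archimedean model. *)
Lemma elementary_growth (expf : formula (oring_ext E) 2) (e0 : M -> M) (e : N -> N)
    (F : rcfType) (f : N -> F) (g : F -> N) :
  archimedean M -> exponential e0 -> defines_fun expf e0 -> defines_fun expf e ->
  rcf_iso f g -> forall x, 0 < x -> 1 + x / 2%:R <= f (e (g x)).
Proof.
move=> ar ee0 def0 def iso.
have [F0 [f0 [iso_g0 iso0]]] := is_rcf_iso Mrcf.
have gr := eF_growth iso0 ee0 ar.
pose P (K : structure (oring_ext E)) (e : nat -> K) := forall x y : K,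
  lt (zero K) x -> sat expf (tnth [tuple x; y]) ->
  ~ lt (add y y) (add (add (one K) (one K)) x).
have dP : isdef P.
  do 2 (apply: isdef_all).
  apply: isdef_imp; first by apply: isdef_lt; [exact: isterm_zero|exact: isterm_var].
  apply: isdef_imp; first by apply: isdef_sat2; exact: isterm_var.
  apply: isdef_not; apply: isdef_lt; apply: isterm_add; try exact: isterm_var.
  by apply: isterm_add; exact: isterm_one.
have PM : P M (fun=> zero M).
  move=> x y /(iso_lt iso0); rewrite (iso_f0 iso0) => x0 /def0 ->.
  move=> /(iso_lt iso0); rewrite !(iso_fD iso0) (iso_f1 iso0).
  by have := gr _ x0; rewrite (iso_fK iso0); lra.
have PN := (elementary_isdef _ ej dP).1 PM.
move=> x x0; have := PN (g x) (e (g x)) _ _.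
rewrite !(iso_lt iso) (iso_f0 iso) !(iso_fD iso) (iso_f1 iso) !(iso_gK iso) => H.
have {H} := H x0 (iffRL (def _ _) erefl) => /negP; rewrite -leNgt; lra.
Qed.

End Transfer.

Section Expansion.
Local Open Scope ring_scope.

(** The expansion of [M] by a predicate for [A]. *)
Definition expand (L : language) (M : structure L) (A : set M) : structure (add_pred L) :=
  @Structure (add_pred L) M
    (fun f => match f return ('I_(@farity (add_pred L) f) -> M) -> M with
              | inl f => @finterp L M f
              | inr f => match f with end
              end)
    (fun r => match r return ('I_(@rarity (add_pred L) r) -> M) -> Prop with
              | inl r => @rinterp L M r
              | inr _ => fun v => A (v ord0)
              end).

Lemma exists_TM_expansion (E : language) (T : theory (oring_ext E))
    (expf : formula (oring_ext E) 2) (R : structure (oring_ext E)) (G : set R) :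
  model T R -> T_convex_subring (finite_part R) -> proper (finite_part R) ->
  monomial_group (finite_part R) G -> T_compatible expf G ->
  exists S : structure (langM E), TM_model T expf S /\
    upred_set (M := reduct S) = finite_part (ring_reduct S).
Proof.
case: R G => car fi ri G TR TO PO OG GT; pose R := Structure fi ri.
by exists (expand (M := expand (finite_part R)) G).
Qed.

End Expansion.

Lemma definable_nat_of_finite (E : language) (T : theory (oring_ext E))
    (expf : formula (oring_ext E) 2) (S : structure (langM E)) :
  extends_rcf T -> defines_exponential T expf -> TM_model T expf S ->
  upred_set (M := reduct S) = finite_part (ring_reduct S) ->
  definable (M := S) (naturals (ring_reduct S)).
Proof.
move=> Trcf Texp SM OE; have [A [dA NA Agt]] := definable_cut Trcf Texp SM.
have [[TR _ _] _ _] := SM.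
have [F [f [g iso]]] := is_rcf_iso (Trcf _ TR).
set R := ring_reduct S in NA Agt OE F f g iso *.
suff -> : naturals R = A `&` [set x : S | (upred_set (M := reduct S) : set R) x].
  apply: definable_setI dA _.
  pose P (M : structure (langM E)) (e : nat -> M) :=
    (upred_set (M := reduct M) : set (ring_reduct M)) (e 0%N).
  have dP : isdef P by apply: isdefM_O; exact: isterm_var.
  exact: (@definable_isdef (langM E) P S (fun=> zero R) dP).
rewrite OE; apply/seteqP; split=> a.
  move=> na; split; first exact: NA.
  have [n _ <-] := na; exists n.+1.
  rewrite !(iso_lt iso) (iso_fN iso) !(iso_nat iso) ltr_nat; split=> //.
  by apply: lt_le_trans (ler0n _ _); rewrite oppr_lt0 ltr0n.
move=> [Aa [n [_ /(iso_lt iso) an]]]; apply: contrapT => na.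
by have /(iso_lt iso) := Agt a Aa na n; rewrite ltNge ltW.
Qed.

(** The valued field is an ultrapower of an archimedean model, with its
    finite elements as valuation ring. *)
Lemma exists_TM_model_definable_nat (E : language) (T : theory (oring_ext E))
    (expf : formula (oring_ext E) 2) (M : structure (oring_ext E)) :
  o_minimal T -> extends_rcf T -> defines_exponential T expf ->
  model T M -> archimedean M ->
  exists S : structure (langM E), TM_model T expf S /\
    definable (M := S) (naturals (ring_reduct S)).
Proof.
move=> Tom Trcf Texp TM ar.
have [U [UU Uge]] := exists_ultrafilter_nat.
pose N := upower U M; have ej := elementary_udiag UU (zero M).
have TN : model T N.
  move=> s /TM; rewrite /holds => /(ej _ s).
  by rewrite (_ : _ \o _ = tnth [tuple]) //; apply/funext => -[].
have TO := T_convex_finite ej (Trcf _ TM) (Trcf _ TN) (Tom _ TM) ar.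
have [F [f [g iso]]] := is_rcf_iso (Trcf _ TN).
have [F0 [f0 [iso_g0 iso0]]] := is_rcf_iso (Trcf _ TM).
have [e ee def] := Texp _ TN.
have [e0 ee0 def0] := Texp _ TM.
have gr := elementary_growth ej (Trcf _ TM) ar ee0 def0 def iso.
have PO : proper (finite_part N).
  exists (upi U (fun n => natr M n)) => -[n [_]].
  rewrite -(elementary_natr ej) => /lt_upower h.
  have [i [/= ni [+ [E1 E2]]]] := filter_ex (filterI (Uge n) (filterI h (filterI
    (urepr_upi UU (fun n => natr M n)) (urepr_upi UU (fun=> natr M n))))).
  rewrite /udiag E1 E2 => /(iso_lt iso0).
  by rewrite !(iso_nat iso0) ltr_nat ltnNge ni.
have [sO cO OT] := TO.
have [l lK] := eF_log iso ee.
pose OF : set F := [set x | finite_part N (g x)].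
have Oe x : OF x -> OF (f (e (g x))).
  rewrite /OF /= (iso_fK iso) => Ox; apply: OT => //; first by exists expf.
  exact: (exp_continuous iso ee).
have O1 : OF 1%R := OF1 iso sO; have OM := OFM iso sO.
have [GF [[GF0 GF1 GFM GFV] [GFinj GFsurj GFe]]] :=
  exists_monomials O1 (OFB iso sO) OM (OFcv iso cO) (eFD iso ee)
    (eF_gt0 iso ee) (eF_mono iso ee) lK Oe gr.
pose G : set N := [set x | GF (f x)].
have [|||||S [SM SO]] := @exists_TM_expansion E T expf N G => //.
- split; first split.
  + by move=> x Gx x0; have := GF0 _ Gx; rewrite x0 (iso_f0 iso) ltxx.
  + by rewrite /G /= (iso_f1 iso).
  + by move=> x y Gx Gy; rewrite /G /= (iso_fM iso); exact: GFM.
  + move=> x y Gx xy; rewrite /G /=; suff -> : f y = ((f x)^-1)%R by exact: GFV.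
    have x0 := lt0r_neq0 (GF0 _ Gx).
    by apply: (mulfI x0); rewrite mulfV // -(iso_fM iso) xy (iso_f1 iso).
  + split.
    * move=> x Gx; exists x => //; move=> x0.
      by have := GF0 _ Gx; rewrite x0 (iso_f0 iso) ltxx.
    * move=> x y; rewrite !in_setE => Gx Gy /(valuationP iso sO) xy.
      by apply: (iso_inj iso); exact: GFinj.
    * move=> _ [x x0 <-]; have fx0 : f x != 0%R.
        by apply/eqP => fx0; apply: x0; apply: (iso_inj iso); rewrite fx0 (iso_f0 iso).
      have [y Gy yx] := GFsurj _ fx0; exists (g y); first by rewrite /G /= (iso_gK iso).
      by apply/(valuationP iso sO); rewrite (iso_gK iso).
- move=> m y Gm /(iso_lt iso); rewrite (iso_f1 iso) => m1 /def ->.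
  have := GFe _ Gm m1; rewrite (iso_fK iso) => Ge; split=> //.
  apply/(iso_lt iso); rewrite (iso_f1 iso).
  have := exp_gt1 (eFD iso ee) (eF_gt0 iso ee) (eF_mono iso ee) (f m).
  by rewrite (iso_fK iso) => ->; exact: lt_trans m1.
by exists S; split=> //; exact: definable_nat_of_finite SM SO.
Qed.

Theorem corollary5p3 (E : language) (T : theory (oring_ext E))
    (expf : formula (oring_ext E) 2) :
  complete T -> o_minimal T -> extends_rcf T -> defines_exponential T expf ->
  (forall S : structure (langM E), TM_model T expf S ->
     exists A : set S,
       [/\ definable A,
           naturals (ring_reduct S) `<=` A
         & forall a : ring_reduct S, A a -> ~ naturals (ring_reduct S) a ->
             forall n : nat, lt (natr (ring_reduct S) n) a]) /\
  (forall S : structure (langM E), TM_model T expf S ->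
     externally_definable (M := S) (naturals (ring_reduct S))) /\
  ((exists R : structure (oring_ext E), model T R /\ archimedean R) ->
   exists S : structure (langM E), TM_model T expf S /\
     definable (M := S) (naturals (ring_reduct S))).
Proof.
move=> _ Tom Trcf Texp; split; first exact: definable_cut.
split; first exact: externally_definable_nat.
move=> [M [TM ar]]; exact: exists_TM_model_definable_nat TM ar.
Qed.
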